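(* Let $\Omega=\Omega(A)$ be a fixed differential graded algebra of classical type. Let $\mathcal D$ be the set of degree $-1$ linear maps $\delta$ on $\Omega$ of classical type, $\mathcal D^\times\subseteq\mathcal D$ the subset where the associated metric inner product $(\ ,\ )$ is invertible, and $\mathcal I$ the vector space of interior coderivations. Let $\Theta$ be the map sending $\delta\in\mathcal D$ to the pair $\Theta(\delta)=((\ ,\ ),\nabla)$ where $(\ ,\ )$ is the associated metric inner product and $\nabla_\omega\eta=\frac12(L_\delta(\omega,\eta)+\mathcal L_\omega\eta+(\mathrm d\omega)\perp\eta)$ for $\omega\in\Omega^1$, $\eta\in\Omega$. Then $\mathcal I$ acts on $\mathcal D$ and on $\mathcal D^\times$ by addition, $\Theta$ descends to the quotient $\mathcal D/\mathcal I$ and is injective there. Moreover, $\Theta$ restricts to a bijection from $\mathcal D^\times/\mathcal I$ to the set of pairs $((\ ,\ ),\nabla)$ consisting of an invertible symmetric metric inner product and an associated covariant derivative, i.e. a metric compatible torsion free covariant derivative $\nabla$ on $\Omega$ acting by derivations.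
   Context: $k$ is a field of characteristic $\neq 2$ and $A$ a unital $k$-algebra. A DGA on $A$ is an associative graded algebra $\Omega=\oplus_{n\ge0}\Omega^n$ with $\Omega^0=A$ and a graded derivation $\mathrm d:\Omega^n\to\Omega^{n+1}$, $\mathrm d^2=0$. It is standard if $\Omega^1$ is spanned by elements $a\,\mathrm db$ and $\Omega$ is generated by degrees $0,1$. It is of classical type if it is standard, graded-commutative, and equal to the tensor algebra of $\Omega^1$ over $A$ modulo the relations of antisymmetry. A degree $-1$ linear map $\delta$ on $\Omega$ is of classical type if: there is an $A$-bilinear map $\mathfrak i:\Omega^1\otimes_A\Omega^n\to\Omega^{n-1}$ with $\delta(a\omega)=a\delta\omega+\mathfrak i_{\mathrm da}\omega$; $\delta^2$ is $A$-linear; each $\mathfrak i_{\mathrm da}$ is a graded derivation of degree $-1$; and $\mathfrak i_{\mathrm da}(\mathrm db)=\mathfrak i_{\mathrm db}(\mathrm da)$ for all $a,b\in A$. The associated metric inner product is $(\omega,\eta)=\mathfrak i_\omega\eta$, $\omega,\eta\in\Omega^1$. It is invertible if there is $g=g^1\otimes g^2\in\Omega^1\otimes_A\Omega^1$ (sum understood) with $(\omega,g^1)g^2=\omega=g^1(g^2,\omega)$ for all $\omega\in\Omega^1$. $L_\delta(\omega,\eta)=\delta(\omega\eta)-(\delta\omega)\eta-(-1)^{|\omega|}\omega\delta\eta$; $\mathcal L_\omega=\mathrm d\mathfrak i_\omega+\mathfrak i_\omega\mathrm d$; $(\omega_1\cdots\omega_m)\perp(\eta_1\cdots\eta_n)=\sum_{i,j}(-1)^{i+j}(\omega_i,\eta_j)\omega_1\cdots\widehat{\omega_i}\cdots\omega_m\eta_1\cdots\widehat{\eta_j}\cdots\eta_n$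 for $\omega_i,\eta_j\in\Omega^1$ (zero if an argument has degree $0$). An interior coderivation is an $A$-module map $v:\Omega^1\to A$ extended to a degree $-1$ graded derivation of $\Omega$ (vanishing on $A$). A covariant derivative is a bilinear map $\nabla:\Omega^1\times\Omega\to\Omega$, $\nabla_\omega$ preserving degree, with $\nabla_{a\omega}=a\nabla_\omega$, $\nabla_\omega(a\eta)=a\nabla_\omega\eta+(\omega,\mathrm da)\eta$. It is metric compatible if $(\omega,\mathrm d(\eta,\zeta))=(\nabla_\omega\eta,\zeta)+(\eta,\nabla_\omega\zeta)$ and torsion free if $(\omega,\nabla_\eta\zeta)-(\eta,\nabla_\omega\zeta)=\mathfrak i_\omega\mathfrak i_\eta\mathrm d\zeta$ for all $\omega,\eta,\zeta\in\Omega^1$, where $\mathfrak i_\omega$ is the degree $-1$ graded derivation extending $(\omega,\ )$. *)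

(* Defs.v *)
From HB Require Import structures.
From mathcomp Require Import all_boot all_order all_algebra.
From mathcomp Require Import boolp classical_sets functions.

Set Implicit Arguments.
Unset Strict Implicit.
Unset Printing Implicit Defensive.

Import GRing.Theory.
Local Open Scope ring_scope.

Record dga (k : fieldType) (A : algType k) := Dga {
  dga_sort :> algType k;
  degree : nat -> {pred dga_sort};
  (* the identification of [A] with the degree 0 part *)
  of_alg : {lrmorphism A -> dga_sort};
  diff : {linear dga_sort -> dga_sort};
  degree_submod : forall n, submod_closed (degree n);
  of_alg_inj : injective of_alg;
  degree0P : forall x, x \in degree 0 <-> exists a, x = of_alg a;
  degreeM : forall m n x y,
    x \in degree m -> y \in degree n -> x * y \in degree (m + n);
  degree_span : forall x, exists (n : nat) (c : nat -> dga_sort),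
    (forall i, c i \in degree i) /\ x = \sum_(i < n) c i;
  degree_direct : forall (n : nat) (c : nat -> dga_sort),
    (forall i, c i \in degree i) -> \sum_(i < n) c i = 0 ->
    forall i, (i < n)%N -> c i = 0;
  diff_degree : forall n x, x \in degree n -> diff x \in degree n.+1;
  diffM : forall n x y,
    x \in degree n -> diff (x * y) = diff x * y + (-1) ^+ n * (x * diff y);
  diff_diff : forall x, diff (diff x) = 0
}.

Arguments degree {k A} d n : rename.

Section OneForms.
Variables (k : fieldType) (A : algType k) (Omega : dga A).

HB.instance Definition _ n := GRing.isSubmodClosed.Build k Omega
  (degree Omega n) (@degree_submod k A Omega n).

Definition form1 : Type := {x : Omega | x \in degree Omega 1}.

HB.instance Definition _ := SubChoice.on form1.
HB.instance Definition _ := [SubChoice_isSubZmodule of form1 by <:].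

Lemma of_alg_degree0 (a : A) : of_alg Omega a \in degree Omega 0.
Proof. by apply/degree0P; exists a. Qed.

Lemma form1_scale_subproof (a : A) (w : form1) :
  of_alg Omega a * val w \in degree Omega 1.
Proof. exact: (degreeM (of_alg_degree0 a) (valP w)). Qed.

Definition form1_scale (a : A) (w : form1) : form1 :=
  exist _ (of_alg Omega a * val w) (form1_scale_subproof a w).

Fact form1_scaleA a b w :
  form1_scale a (form1_scale b w) = form1_scale (a * b) w.
Proof. by apply: val_inj; rewrite /= rmorphM mulrA. Qed.

Fact form1_scale1 : left_id 1 form1_scale.
Proof. by move=> w; apply: val_inj; rewrite /= rmorph1 mul1r. Qed.

Fact form1_scaleDr : right_distributive form1_scale +%R.
Proof. by move=> a v w; apply: val_inj; rewrite /= mulrDr. Qed.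

Fact form1_scaleDl w : {morph form1_scale^~ w : a b / a + b}.
Proof. by move=> a b; apply: val_inj; rewrite /= rmorphD mulrDl. Qed.

(* [a *: w] is the left action of [a : A], not of a scalar in [k] *)
HB.instance Definition _ := GRing.Zmodule_isLmodule.Build A form1
  form1_scaleA form1_scale1 form1_scaleDr form1_scaleDl.

Definition d1 (a : A) : form1 :=
  exist _ (diff Omega (of_alg Omega a)) (diff_degree (of_alg_degree0 a)).

(* Inverses of [val : form1 -> Omega] and [of_alg]; 0 off the images. *)
Definition to_form1 (x : Omega) : form1 := insubd 0 x.
Definition to_alg (x : Omega) : A := xget 0 [set a | of_alg Omega a = x].

End OneForms.

(* The tensor algebra of an [A]-module [M], presented as the ring generated by
   [A] and [M].  [M] is a symmetric bimodule: [teq_central] is the right action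
   [x a = a x]. *)
Inductive texpr (A M : Type) : Type :=
| TAlg of A
| TForm of M
| TAdd of texpr A M & texpr A M
| TMul of texpr A M & texpr A M.
Arguments TAlg {A M}.
Arguments TForm {A M}.
Arguments TAdd {A M}.
Arguments TMul {A M}.

Section TensorAlgebra.
Variables (A : pzRingType) (M : lmodType A).
Local Notation T := (texpr A M).

Inductive tensor_eq : T -> T -> Prop :=
| teq_refl e : tensor_eq e e
| teq_sym e f : tensor_eq e f -> tensor_eq f e
| teq_trans e f g : tensor_eq e f -> tensor_eq f g -> tensor_eq e g
| teq_add e e' f f' :
    tensor_eq e e' -> tensor_eq f f' -> tensor_eq (TAdd e f) (TAdd e' f')
| teq_mul e e' f f' :
    tensor_eq e e' -> tensor_eq f f' -> tensor_eq (TMul e f) (TMul e' f')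
| teq_addA e f g : tensor_eq (TAdd e (TAdd f g)) (TAdd (TAdd e f) g)
| teq_addC e f : tensor_eq (TAdd e f) (TAdd f e)
| teq_add0 e : tensor_eq (TAdd (TAlg 0) e) e
| teq_addN e : tensor_eq (TAdd (TMul (TAlg (-1)) e) e) (TAlg 0)
| teq_mulA e f g : tensor_eq (TMul e (TMul f g)) (TMul (TMul e f) g)
| teq_mul1l e : tensor_eq (TMul (TAlg 1) e) e
| teq_mul1r e : tensor_eq (TMul e (TAlg 1)) e
| teq_mulDl e f g :
    tensor_eq (TMul (TAdd e f) g) (TAdd (TMul e g) (TMul f g))
| teq_mulDr e f g :
    tensor_eq (TMul e (TAdd f g)) (TAdd (TMul e f) (TMul e g))
| teq_algD a b : tensor_eq (TAlg (a + b)) (TAdd (TAlg a) (TAlg b))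
| teq_algM a b : tensor_eq (TAlg (a * b)) (TMul (TAlg a) (TAlg b))
| teq_formD x y : tensor_eq (TForm (x + y)) (TAdd (TForm x) (TForm y))
| teq_formZ a x : tensor_eq (TForm (a *: x)) (TMul (TAlg a) (TForm x))
| teq_central a x :
    tensor_eq (TMul (TForm x) (TAlg a)) (TMul (TAlg a) (TForm x)).

(* equality modulo the two-sided ideal generated by the [x (x) y + y (x) x] *)
Inductive antisym_eq : T -> T -> Prop :=
| aeq_tensor e f : tensor_eq e f -> antisym_eq e f
| aeq_sym e f : antisym_eq e f -> antisym_eq f e
| aeq_trans e f g : antisym_eq e f -> antisym_eq f g -> antisym_eq e g
| aeq_add e e' f f' :
    antisym_eq e e' -> antisym_eq f f' -> antisym_eq (TAdd e f) (TAdd e' f')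
| aeq_mul e e' f f' :
    antisym_eq e e' -> antisym_eq f f' -> antisym_eq (TMul e f) (TMul e' f')
| aeq_antisym x y :
    antisym_eq (TAdd (TMul (TForm x) (TForm y)) (TMul (TForm y) (TForm x)))
               (TAlg 0).

End TensorAlgebra.

Section ClassicalType.
Variables (k : fieldType) (A : algType k) (Omega : dga A).

Fixpoint teval (e : texpr A (form1 Omega)) : Omega :=
  match e with
  | TAlg a => of_alg Omega a
  | TForm w => val w
  | TAdd e f => teval e + teval f
  | TMul e f => teval e * teval f
  end.

Inductive generated01 : Omega -> Prop :=
| gen_deg0 x : x \in degree Omega 0 -> generated01 x
| gen_deg1 x : x \in degree Omega 1 -> generated01 x
| gen_add x y : generated01 x -> generated01 y -> generated01 (x + y)
| gen_mul x y : generated01 x -> generated01 y -> generated01 (x * y).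

Definition standard : Prop :=
  (forall w : form1 Omega,
     exists s : seq (A * A), w = \sum_(p <- s) p.1 *: d1 Omega p.2)
  /\ (forall x, generated01 x).

Definition graded_commutative : Prop :=
  forall m n (x y : Omega), x \in degree Omega m -> y \in degree Omega n ->
    x * y = (-1) ^+ (m * n) * (y * x).

Definition classical_dga : Prop :=
  [/\ standard, graded_commutative
    & forall e f, teval e = teval f <-> antisym_eq e f].

End ClassicalType.

Section Codifferentials.
Variables (k : fieldType) (A : algType k) (Omega : dga A).
Local Notation Omega1 := (form1 Omega).
Local Notation iota := (of_alg Omega).
Local Notation d := (diff Omega).

Definition form_pairing : Type := Omega1 -> Omega1 -> A.
Definition connection : Type := Omega1 -> Omega -> Omega.

Definition lowers_degree (f : Omega -> Omega) : Prop :=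
  (forall x, x \in degree Omega 0 -> f x = 0) /\
  (forall n x, x \in degree Omega n.+1 -> f x \in degree Omega n).

Definition antiderivation (f : Omega -> Omega) : Prop :=
  forall n x y, x \in degree Omega n ->
    f (x * y) = f x * y + (-1) ^+ n * (x * f y).

Definition interior_product (delta : Omega -> Omega)
    (i : Omega1 -> Omega -> Omega) : Prop :=
  [/\ forall w, linear (i w) /\ lowers_degree (i w),
      (forall a w w' x, i (a *: w + w') x = iota a * i w x + i w' x) /\
      (forall a w x, i w (iota a * x) = iota a * i w x),
      forall a x, delta (iota a * x) = iota a * delta x + i (d1 Omega a) x,
      forall a, antiderivation (i (d1 Omega a))
    & forall a b, i (d1 Omega a) (val (d1 Omega b)) =
                  i (d1 Omega b) (val (d1 Omega a))].

Definition classical_codifferential : set (Omega -> Omega) :=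
  [set delta | [/\ linear delta, lowers_degree delta,
     (forall a x, delta (delta (iota a * x)) = iota a * delta (delta x))
     & exists i, interior_product delta i]].

(* [interior_product delta] determines its second argument, since the [d b]
   span the 1-forms and [i (a *: d b) x] is [a (delta (b x) - b delta x)] *)
Definition interior (delta : Omega -> Omega) : Omega1 -> Omega -> Omega :=
  xget (fun _ _ => 0) [set i | interior_product delta i].

Definition metric (delta : Omega -> Omega) : form_pairing :=
  fun w v => to_alg (interior delta w (val v)).

Definition bilinear_pairing (g : form_pairing) : Prop :=
  (forall w, linear (g w : Omega1 -> A^o)) /\
  (forall v, linear ((fun w => g w v) : Omega1 -> A^o)).

Definition symmetric_pairing (g : form_pairing) : Prop :=
  forall w v, g w v = g v w.

(* [s] lists the terms of a tensor in [Omega1 (x)_A Omega1] *)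
Definition invertible_pairing (g : form_pairing) : Prop :=
  exists s : seq (Omega1 * Omega1), forall w,
    \sum_(p <- s) iota (g w p.1) * val p.2 = val w /\
    \sum_(p <- s) val p.1 * iota (g p.2 w) = val w.

Definition invertible_codifferential : set (Omega -> Omega) :=
  [set delta | classical_codifferential delta /\
               invertible_pairing (metric delta)].

Definition extends_form_map (v : Omega1 -> A) (f : Omega -> Omega) : Prop :=
  [/\ linear f, lowers_degree f, antiderivation f
    & forall w, f (val w) = iota (v w)].

Definition interior_coderivation : set (Omega -> Omega) :=
  [set f | exists v : Omega1 -> A,
     linear (v : Omega1 -> A^o) /\ extends_form_map v f].

Definition extension (v : Omega1 -> A) : Omega -> Omega :=
  xget (fun _ => 0) [set f | extends_form_map v f].

(* [L delta m x y] is L_delta(x, y) for [x] of degree [m] *)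
Definition L (delta : Omega -> Omega) (m : nat) (x y : Omega) : Omega :=
  delta (x * y) - delta x * y - (-1) ^+ m * (x * delta y).

Definition Lie (i : Omega1 -> Omega -> Omega) (w : Omega1) (x : Omega) : Omega :=
  d (i w x) + i w (d x).

Definition is_perp (g : form_pairing) (P : Omega -> Omega -> Omega) : Prop :=
  [/\ forall x, linear (P x),
      forall y, linear (fun x => P x y),
      forall x y, x \in degree Omega 0 \/ y \in degree Omega 0 -> P x y = 0
    & forall m n (w : 'I_m -> Omega1) (v : 'I_n -> Omega1),
        P (\prod_(i < m) val (w i)) (\prod_(j < n) val (v j)) =
        \sum_(i < m) \sum_(j < n) (-1) ^+ (i + j) * (iota (g (w i) (v j)) *
          \prod_(l < m | l != i) val (w l) * \prod_(l < n | l != j) val (v l))].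

Definition perp (g : form_pairing) : Omega -> Omega -> Omega :=
  xget (fun _ _ => 0) [set P | is_perp g P].

Definition nabla (delta : Omega -> Omega) : connection := fun w x =>
  2%:R^-1 *: (L delta 1 (val w) x + Lie (interior delta) w x
              + perp (metric delta) (d (val w)) x).

Definition Theta (delta : Omega -> Omega) : form_pairing * connection :=
  (metric delta, nabla delta).

Definition covariant_derivative (g : form_pairing) (D : connection) : Prop :=
  [/\ forall w, linear (D w),
      forall w n x, x \in degree Omega n -> D w x \in degree Omega n,
      forall a w v x, D (a *: w + v) x = iota a * D w x + D v x
    & forall w a x,
        D w (iota a * x) = iota a * D w x + iota (g w (d1 Omega a)) * x].

Definition metric_compatible (g : form_pairing) (D : connection) : Prop :=
  forall w v u : Omega1, g w (d1 Omega (g v u)) =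
    g (to_form1 (D w (val v))) u + g v (to_form1 (D w (val u))).

Definition torsion_free (g : form_pairing) (D : connection) : Prop :=
  forall w v u : Omega1,
    iota (g w (to_form1 (D v (val u))) - g v (to_form1 (D w (val u)))) =
    extension (g w) (extension (g v) (d (val u))).

Definition acts_by_derivations (D : connection) : Prop :=
  forall w x y, D w (x * y) = D w x * y + x * D w y.

Definition riemannian_pair : set (form_pairing * connection) :=
  [set p | [/\ bilinear_pairing p.1, symmetric_pairing p.1
             & invertible_pairing p.1] /\
           [/\ covariant_derivative p.1 p.2, metric_compatible p.1 p.2,
               torsion_free p.1 p.2 & acts_by_derivations p.2]].

Definition coset (delta : Omega -> Omega) : set (Omega -> Omega) :=
  [set delta \+ v | v in interior_coderivation]%classic.

Definition quotient (S : set (Omega -> Omega)) : set (set (Omega -> Omega)) :=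
  [set coset delta | delta in S]%classic.

End Codifferentials.

(* Main.v *)
(* A graded map f with f(a x) = a f(x) + alpha_a(x) and f(w x) = alpha_w(x) - w f(x)
   for a in A and w a 1-form exists as soon as alpha respects the relations of the
   exterior algebra: let A and the 1-forms act on Omega x Omega so that x sends
   (1, 0) to (x, f x).  Interior derivations, the product _|_ and the codifferential
   with prescribed (g, nabla) are all obtained in this way.

   If delta is of classical type, A-linearity of delta^2 means that delta
   anticommutes with i_da, and then [i_da, L_w] = - i_{d(da, w)} for
   L_w = L_delta(w, _).  The failure of L_w to be a derivation is therefore killed,
   by induction on the degree, by all i_da, and so vanishes if the metric is
   invertible.  That positive-degree forms are separated by interior products in
   any characteristic follows from the algebra endomorphism extending
   w |-> w - sum g^1 (g^2, w) = 0: it fixes whatever is killed by all i_{g^2}.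
   The metric and torsion conditions need only be checked on exact forms.

   Conversely (g, nabla) forces L_w = 2 nabla_w - Lie_w - (dw) _|_, and setting
   delta w = (g^1, nabla_{g^2} w) on 1-forms the recursion is consistent because
   metric compatibility and torsion-freeness give
   nabla_w u + nabla_u w = d(w, u) + i_w du + i_u dw.  Two codifferentials with the
   same image under Theta have the same L, so they differ by an antiderivation. *)
Require Import Defs.
From HB Require Import structures.
From mathcomp Require Import all_boot all_order all_algebra.
From mathcomp Require Import boolp classical_sets functions.
From Stdlib Require Ncring Ncring_tac.

Set Implicit Arguments.
Unset Strict Implicit.
Unset Printing Implicit Defensive.

Import GRing.Theory.
Local Open Scope ring_scope.

(** * Noncommutative ring identities *)

Section NonCommutativeRing.
Variable R : nzRingType.

(** Makes the noncommutative normalization tactic available over Leibniz equality, since forms do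
    not commute. *)
#[global] Instance nzRing_ops :
  @Ncring.Ring_ops R 0 1 +%R *%R (fun x y => x - y) -%R (@eq R) := {}.

#[global] Instance nzRing_Ring : Ncring.Ring (Ro := nzRing_ops).
Proof.
split=> //=; try exact: _.
all: rewrite /Algebra_syntax.equality /Algebra_syntax.addition
  /Algebra_syntax.multiplication /Algebra_syntax.opposite /Algebra_syntax.zero
  /Algebra_syntax.one /Algebra_syntax.subtraction /=.
all: rewrite ?/Ncring.eq_notation ?/Ncring.add_notation ?/Ncring.mul_notation
  ?/Ncring.opp_notation ?/Ncring.zero_notation ?/Ncring.one_notation
  ?/Ncring.sub_notation.
- exact: add0r.
- exact: addrC.
- exact: addrA.
- exact: mul1r.
- exact: mulr1.
- exact: mulrA.
- exact: mulrDl.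
- by move=> x y z; rewrite mulrDr.
- exact: subrr.
Qed.

End NonCommutativeRing.

Ltac ncring := Ncring_tac.non_commutative_ring.

(** * Bare functions satisfying the predicate [linear] *)

Section LinearFunctions.
Variables (R : pzRingType) (U V : lmodType R) (f : U -> V).
Hypothesis f_lin : linear f.

Lemma linear_add x y : f (x + y) = f x + f y.
Proof. by have := f_lin 1 x y; rewrite !scale1r. Qed.

Lemma linear_zero : f 0 = 0.
Proof. by apply: (addIr (f 0)); rewrite -linear_add !add0r. Qed.

Lemma linear_scale a x : f (a *: x) = a *: f x.
Proof. by have := f_lin a x 0; rewrite !addr0 linear_zero addr0. Qed.

Lemma linear_opp x : f (- x) = - f x.
Proof. by rewrite -scaleN1r linear_scale scaleN1r. Qed.

Lemma linear_sub x y : f (x - y) = f x - f y.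
Proof. by rewrite linear_add linear_opp. Qed.

Lemma linear_bigsum I (s : seq I) (F : I -> U) :
  f (\sum_(i <- s) F i) = \sum_(i <- s) f (F i).
Proof. exact: (big_morph f linear_add linear_zero). Qed.

End LinearFunctions.

(** * Forms as an exterior algebra *)

Section ClassicalType.
Variables (k : fieldType) (char_k : 2%N \notin [pchar k]) (A : algType k)
  (Omega : dga A) (Omega_classical : classical_dga Omega).
Local Notation Omega1 := (form1 Omega).
Local Notation iota := (of_alg Omega).
Local Notation d := (diff Omega).
Local Notation deg := (degree Omega).

Lemma two_neq0 : 2%:R != 0 :> k.
Proof. by apply: contra char_k => h; rewrite inE /= h. Qed.

(** Lets identities for [nabla] be checked after doubling, which removes the factor one half. *)
Lemma double_inj (x y : Omega) : x + x = y + y -> x = y.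
Proof.
move=> e; apply: (scalerI two_neq0).
by rewrite !scaler_nat !mulr2n.
Qed.

Lemma double_eq0 (x : Omega) : x + x = 0 -> x = 0.
Proof. by move=> e; apply: double_inj; rewrite e addr0. Qed.

Lemma iota0 : iota 0 = 0. Proof. exact: rmorph0. Qed.

Lemma iota1 : iota 1 = 1. Proof. exact: rmorph1. Qed.

Lemma iotaN a : iota (- a) = - iota a. Proof. exact: rmorphN. Qed.

Lemma iotaD a b : iota (a + b) = iota a + iota b. Proof. exact: rmorphD. Qed.

Lemma iotaB a b : iota (a - b) = iota a - iota b. Proof. exact: rmorphB. Qed.

Lemma iotaM a b : iota (a * b) = iota a * iota b. Proof. exact: rmorphM. Qed.

Lemma iota_scale (c : k) (x : Omega) : c *: x = iota c%:A * x.
Proof. by rewrite linearZ rmorph1 -scalerAl mul1r. Qed.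

Lemma form1_valD (w v : Omega1) : val (w + v) = val w + val v.
Proof. by []. Qed.

Lemma form1_valZ a (w : Omega1) : val (a *: w) = iota a * val w.
Proof. by []. Qed.

Lemma form1_val0 : val (0 : Omega1) = 0.
Proof. by []. Qed.

Lemma form1_val_sum I (s : seq I) (F : I -> Omega1) :
  val (\sum_(i <- s) F i) = \sum_(i <- s) val (F i).
Proof. exact: (big_morph _ form1_valD form1_val0). Qed.

Lemma to_form1K x : x \in deg 1 -> val (to_form1 x) = x.
Proof. by move=> h; rewrite /to_form1 insubdK. Qed.

Lemma to_algK a : to_alg (iota a) = a.
Proof.
apply: (@of_alg_inj _ _ Omega); rewrite /to_alg.
by case: xgetP => [b _ //|/(_ a)/=]; case.
Qed.

Lemma iota_to_alg x : x \in deg 0 -> iota (to_alg x) = x.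
Proof. by move=> /degree0P[a ->]; rewrite to_algK. Qed.

Lemma iota_deg a : iota a \in deg 0.
Proof. exact: of_alg_degree0. Qed.

Lemma iotaM_deg n a x : x \in deg n -> iota a * x \in deg n.
Proof. exact: (degreeM (iota_deg a)). Qed.

Lemma formM_deg n (w : Omega1) x : x \in deg n -> val w * x \in deg n.+1.
Proof. exact: (degreeM (valP w)). Qed.

Lemma iotaC a x : x * iota a = iota a * x.
Proof.
have [n [c [hc ->]]] := degree_span x.
rewrite mulr_suml mulr_sumr; apply: eq_bigr => i _.
have [_ gc _] := Omega_classical.
by rewrite (gc _ _ _ _ (hc i) (iota_deg a)) muln0 expr0 mul1r.
Qed.

Lemma iotaCA a x y : x * (iota a * y) = iota a * (x * y).
Proof. by rewrite mulrA iotaC mulrA. Qed.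

Lemma algC (a b : A) : a * b = b * a.
Proof. by apply: (@of_alg_inj _ _ Omega); rewrite !iotaM iotaC. Qed.

Lemma algCA (a b c : A) : a * (b * c) = b * (a * c).
Proof. by rewrite mulrA (algC a) mulrA. Qed.

Lemma formC (w v : Omega1) : val w * val v = - (val v * val w).
Proof.
have [_ gc _] := Omega_classical.
by rewrite (gc _ _ _ _ (valP w) (valP v)) expr1 mulN1r.
Qed.

Lemma formCA (w v : Omega1) x : val w * (val v * x) = - (val v * (val w * x)).
Proof. by rewrite mulrA formC mulNr mulrA. Qed.

(** Antisymmetry only gives that twice the square vanishes; characteristic different from 2 does the
    rest. *)
Lemma form_sq (w : Omega1) : val w * val w = 0.
Proof. by apply: double_eq0; rewrite {1}formC addNr. Qed.

Lemma signCA n (x y : Omega) : x * ((-1) ^+ n * y) = (-1) ^+ n * (x * y).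
Proof. by rewrite -signr_odd; case: (odd n); rewrite ?expr0 ?expr1; ncring. Qed.

(** An inductive presentation of the degree [n] part by words in 1-forms ending in an element of
    [A]. [degree_homogeneous] identifies it with [degree], which makes induction on degree
    possible. *)
Inductive homogeneous : nat -> Omega -> Prop :=
| hom_alg a : homogeneous 0 (iota a)
| hom_zero n : homogeneous n 0
| hom_add n x y : homogeneous n x -> homogeneous n y -> homogeneous n (x + y)
| hom_form n (w : Omega1) x : homogeneous n x -> homogeneous n.+1 (val w * x).

Lemma homogeneous_deg n x : homogeneous n x -> x \in deg n.
Proof.
elim=> {n x} [a|n|n x y _ hx _ hy|n w x _ hx].
- exact: iota_deg.
- exact: rpred0.
- exact: rpredD.
- exact: formM_deg.
Qed.

Lemma homogeneous_scale n a x : homogeneous n x -> homogeneous n (iota a * x).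
Proof.
elim=> {n x} [b|n|n x y _ hx _ hy|n w x hx _].
- by rewrite -iotaM; apply: hom_alg.
- by rewrite mulr0; apply: hom_zero.
- by rewrite mulrDr; apply: hom_add.
- by rewrite mulrA -(form1_valZ a w); apply: hom_form.
Qed.

(** Generalizing to [P (x * z)] for every [z] satisfying [P] lets an arbitrary product be absorbed
    one factor at a time from the left. *)
Lemma generated_form1_ind (P : Omega -> Prop) :
  P 1 -> (forall x y, P x -> P y -> P (x + y)) ->
  (forall a x, P x -> P (iota a * x)) ->
  (forall (w : Omega1) x, P x -> P (val w * x)) -> forall x, P x.
Proof.
move=> P1 PD Pa Pw x; rewrite -[x]mulr1; move: (1) P1.
have [[_ /(_ x) gx] _ _] := Omega_classical.
elim: gx => {x} [x /degree0P[a ->]|x hx|x y _ IHx _ IHy|x y _ IHx _ IHy] z Pz.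
- exact: Pa.
- by rewrite -(to_form1K hx); apply: Pw.
- by rewrite mulrDl; apply: PD; [apply: IHx|apply: IHy].
- by rewrite -mulrA; apply/IHx/IHy.
Qed.

Lemma homogeneous_decomposition x :
  exists (n : nat) (c : nat -> Omega),
    (forall i, homogeneous i (c i)) /\ x = \sum_(i < n) c i.
Proof.
elim/generated_form1_ind: x => [|x y [m [b [hb ->]]] [n [c [hc ->]]]|a x|w x].
- exists 1%N, (fun i => if i == 0%N then 1 else 0); split; last first.
    by rewrite big_ord1.
  case=> [|i] /=; last exact: hom_zero.
  by rewrite -iota1; apply: hom_alg.
- exists (m + n)%N, (fun i => (if (i < m)%N then b i else 0) +
                              (if (i < n)%N then c i else 0)); split.
    by move=> i; apply: hom_add; case: ifP => // _; apply: hom_zero.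
  rewrite big_split /= -!big_mkcond /=.
  by rewrite (big_ord_widen (m + n) b) ?leq_addr // (big_ord_widen (m + n) c) ?leq_addl.
- case=> n [c [hc ->]]; exists n, (fun i => iota a * c i); split.
    by move=> i; apply: homogeneous_scale.
  by rewrite mulr_sumr.
- case=> n [c [hc ->]]; exists n.+1, (fun i => if i is j.+1 then val w * c j else 0).
  split; first by case=> [|i]; [apply: hom_zero|apply: hom_form].
  by rewrite big_ord_recl add0r mulr_sumr.
Qed.

Lemma degree_homogeneous n x : x \in deg n -> homogeneous n x.
Proof.
move=> hx; have [N [c [hc ex]]] := homogeneous_decomposition x.
(* The difference of two decompositions of [x]: the one by generators and the one concentrated in
   degree [n]. Its sum is 0, so directness kills the component [b n]. *)
pose b i := (if (i < N)%N then c i else 0) - (if i == n then x else 0).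
have hb i : b i \in deg i.
  rewrite /b rpredB //; first by case: ifP => _; [exact: homogeneous_deg|exact: rpred0].
  by case: eqP => [->//|_]; exact: rpred0.
have : b n = 0.
  (* The range has to contain all indices below [N] and also [n] itself. *)
  apply: (degree_direct (n := N + n.+1)) (hb) _ _ _; last by rewrite addnS ltnS leq_addl.
  have lt_n : (n < N + n.+1)%N by rewrite addnS ltnS leq_addl.
  rewrite sumrB -!big_mkcond /= -(big_ord_widen _ c) ?leq_addr // -ex.
  by rewrite (big_pred1 (Ordinal lt_n)) ?subrr // => i; rewrite -(inj_eq val_inj).
rewrite /b eqxx => /subr0_eq <-.
by case: ifP => _; [exact: hc|exact: hom_zero].
Qed.

Lemma degree_ind (P : nat -> Omega -> Prop) :
  (forall a, P 0%N (iota a)) -> (forall n, P n 0) ->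
  (forall n x y, P n x -> P n y -> P n (x + y)) ->
  (forall n (w : Omega1) x, x \in deg n -> P n x -> P n.+1 (val w * x)) ->
  forall n x, x \in deg n -> P n x.
Proof.
move=> Pa P0 PD Pw n x /degree_homogeneous.
elim=> {n x} // [n x y _ hx _ hy|n w x hx Px]; first exact: PD.
by apply: Pw => //; apply: homogeneous_deg.
Qed.

Lemma degreeS_ind n (P : Omega -> Prop) :
  P 0 -> (forall x y, P x -> P y -> P (x + y)) ->
  (forall (w : Omega1) x, x \in deg n -> P (val w * x)) ->
  forall x, x \in deg n.+1 -> P x.
Proof.
move=> P0 PD Pw x hx.
(* [degree_ind] ranges over all degrees, so the fixed one is recorded as an equation inside [Q]. *)
pose Q m x := if m is m'.+1 then m' = n -> P x else True.
suff /(_ erefl) : Q n.+1 x by [].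
apply: (degree_ind (P := Q)) hx => //= [[|m]|[|m]|m w y hy _ e] //=.
- by move=> y z hy hz e; apply: PD; [apply: hy|apply: hz].
- by subst m; apply: Pw.
Qed.

Lemma degree2_ind (P : Omega -> Prop) :
  P 0 -> (forall x y, P x -> P y -> P (x + y)) ->
  (forall w v : Omega1, P (val w * val v)) -> forall x, x \in deg 2 -> P x.
Proof.
move=> P0 PD Pw; apply: degreeS_ind => // w x hx.
by rewrite -(to_form1K hx); apply: Pw.
Qed.

(** This is standardness: the exact forms span the 1-forms over [A], so tensorial identities reduce
    to them. *)
Lemma exact_ind (P : Omega1 -> Prop) :
  P 0 -> (forall w v, P w -> P v -> P (w + v)) ->
  (forall a w, P w -> P (a *: w)) -> (forall a, P (d1 Omega a)) -> forall w, P w.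
Proof.
move=> P0 PD PZ Pd w; have [[/(_ w)[s ->] _] _ _] := Omega_classical.
elim: s => [|p s IHs]; first by rewrite big_nil.
by rewrite big_cons; apply: PD => //; apply: PZ.
Qed.

(** * Maps defined by left recursion *)

Section LeftRecursion.
Variables (actA : A -> Omega -> Omega) (actM : Omega1 -> Omega -> Omega).
Hypotheses
  (actA_addl : forall a b x, actA (a + b) x = actA a x + actA b x)
  (actA_addr : forall a x y, actA a (x + y) = actA a x + actA a y)
  (actM_addl : forall w v x, actM (w + v) x = actM w x + actM v x)
  (actM_addr : forall w x y, actM w (x + y) = actM w x + actM w y)
  (actA_mul : forall a b x, actA (a * b) x = iota a * actA b x + actA a (iota b * x))
  (actM_scale : forall a w x,
     actM (a *: w) x = iota a * actM w x + actA a (val w * x))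
  (actM_central : forall w a x,
     actM w (iota a * x) - val w * actA a x = iota a * actM w x + actA a (val w * x))
  (actM_antisym : forall w v x,
     actM w (val v * x) - val w * actM v x + (actM v (val w * x) - val v * actM w x) = 0).

(* [x = (y, z)] stands for [z = f y]; the clauses are the two defining equations of [f] *)
Fixpoint tact (e : texpr A Omega1) (x : Omega * Omega) : Omega * Omega :=
  match e with
  | TAlg a => (iota a * x.1, iota a * x.2 + actA a x.1)
  | TForm w => (val w * x.1, actM w x.1 - val w * x.2)
  | TAdd e f => tact e x + tact f x
  | TMul e f => tact e (tact f x)
  end.

Let actA0 x : actA 0 x = 0.
Proof. by apply: (addIr (actA 0 x)); rewrite -actA_addl !add0r. Qed.

Let actA1 x : actA 1 x = 0.
Proof.
have := actA_mul 1 1 x; rewrite mulr1 iota1 !mul1r => e.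
by apply: (addIr (actA 1 x)); rewrite add0r -e.
Qed.

Let actAN1 x : actA (-1) x = 0.
Proof. by have := actA_addl 1 (-1) x; rewrite subrr actA0 actA1 add0r. Qed.

Lemma tact_add e x y : tact e (x + y) = tact e x + tact e y.
Proof.
elim: e x y => [a|w|e IHe f IHf|e IHe f IHf] x y /=.
- by congr pair; rewrite /= ?actA_addr !mulrDr // addrACA.
- by congr pair; rewrite /= ?actM_addr !mulrDr // opprD addrACA.
- by rewrite IHe IHf addrACA.
- by rewrite IHf IHe.
Qed.

(** The first component is multiplication in [Omega], where the relations hold. In the second, each
    relation involving [actA] or [actM] is covered by the matching hypothesis on them. *)
Lemma tact_tensor_eq e f : tensor_eq e f -> tact e =1 tact f.
Proof.
elim=> {e f} //=.
- by move=> e f _ h x; rewrite h.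
- by move=> e f g _ h _ h' x; rewrite h h'.
- by move=> e e' f f' _ h _ h' x; rewrite h h'.
- by move=> e e' f f' _ h _ h' x; rewrite h' h.
- by move=> e f g x; rewrite addrA.
- by move=> e f x; rewrite addrC.
- by move=> e x; rewrite iota0 !mul0r actA0 addr0 add0r.
- move=> e x; rewrite iotaN iota1 iota0 !mulN1r !mul0r actAN1 actA0 !addr0.
  by congr pair; rewrite /= addNr.
- by move=> e [x y] /=; rewrite iota1 !mul1r actA1 addr0; case: (tact e _).
- by move=> e [x y] /=; rewrite iota1 !mul1r actA1 addr0.
- by move=> e f g x; rewrite tact_add.
- move=> a b [x y] /=; congr pair; rewrite /= ?iotaD ?actA_addl !mulrDl //.
  by rewrite addrACA.
- move=> a b [x y] /=; rewrite iotaM; congr pair; rewrite /= ?mulrA //.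
  by rewrite actA_mul mulrDr mulrA addrA.
- move=> w v [x y] /=; congr pair; rewrite /= ?actM_addl !mulrDl //.
  by rewrite opprD addrACA.
- move=> a w [x y] /=; congr pair; rewrite /= -?mulrA //.
  rewrite actM_scale mulrBr; ncring.
- move=> a w [x y] /=; congr pair; rewrite /= ?iotaCA //.
  rewrite mulrDr mulrBr iotaCA.
  have := actM_central w a x; move: (actM _ _) => p e.
  rewrite opprD addrA addrAC e; ncring.
Qed.

(** For the new relation the terms in the second component [y] cancel by [formCA], and
    [actM_antisym] removes the others. *)
Lemma tact_antisym_eq e f : antisym_eq e f -> tact e =1 tact f.
Proof.
elim=> {e f} //=.
- exact: tact_tensor_eq.
- by move=> e f _ h x; rewrite h.
- by move=> e f g _ h _ h' x; rewrite h h'.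
- by move=> e e' f f' _ h _ h' x; rewrite h h'.
- by move=> e e' f f' _ h _ h' x; rewrite h' h.
- move=> w v [x y] /=; rewrite iota0 !mul0r actA0 addr0; congr pair => /=.
    by rewrite formCA addNr.
  rewrite !mulrBr (formCA w v y) -[RHS](actM_antisym w v x); ncring.
Qed.

Lemma teval_surjective x : exists e : texpr A Omega1, teval e = x.
Proof.
have [[_ /(_ x) gx] _ _] := Omega_classical.
elim: gx => {x} [x /degree0P[a ->]|x hx|x y _ [e <-] _ [f <-]|x y _ [e <-] _ [f <-]].
- by exists (TAlg a).
- by exists (TForm (to_form1 x)); rewrite /= to_form1K.
- by exists (TAdd e f).
- by exists (TMul e f).
Qed.

Lemma tact1 e x : (tact e x).1 = teval e * x.1 :> Omega.
Proof.
elim: e x => [a|w|e IHe f IHf|e IHe f IHf] x //=.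
- by rewrite IHe IHf mulrDl.
- by rewrite IHe IHf mulrA.
Qed.

(** Expressions with equal value are related by [antisym_eq] and therefore act equally, so [f x] can
    be read off the action on [(1, 0)] of any expression [E x] representing [x]. *)
Lemma left_recursion : exists f : Omega -> Omega,
  [/\ forall x y, f (x + y) = f x + f y, f 1 = 0,
      forall a x, f (iota a * x) = iota a * f x + actA a x
    & forall w x, f (val w * x) = actM w x - val w * f x].
Proof.
have /choice [E HE] := teval_surjective.
have tactE e : tact (E (teval e)) (1, 0) = tact e (1, 0).
  have [_ _ /(_ (E (teval e)) e) [h _]] := Omega_classical.
  by apply: tact_antisym_eq; apply: h; rewrite HE.
have E1 x : (tact (E x) (1, 0)).1 = x by rewrite tact1 HE mulr1.
exists (fun x => (tact (E x) (1, 0)).2); split.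
- move=> x y; have := tactE (TAdd (E x) (E y)).
  by rewrite /= !HE => ->.
- have := tactE (TAlg 1); rewrite /= iota1 => ->.
  by rewrite /= mulr0 actA1 addr0.
- move=> a x; have := tactE (TMul (TAlg a) (E x)).
  by rewrite /= !HE => -> /=; rewrite E1.
- move=> w x; have := tactE (TMul (TForm w) (E x)).
  by rewrite /= !HE => -> /=; rewrite E1.
Qed.

End LeftRecursion.

Lemma additive_zero (f : Omega -> Omega) :
  (forall x y, f (x + y) = f x + f y) -> f 0 = 0.
Proof. by move=> fD; apply: (addIr (f 0)); rewrite -fD !add0r. Qed.

Lemma module_map_linear (f : Omega -> Omega) :
  (forall x y, f (x + y) = f x + f y) ->
  (forall (c : k) x, f (iota c%:A * x) = iota c%:A * f x) -> linear f.
Proof. by move=> fD fZ c x y; rewrite fD !iota_scale fZ. Qed.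

(** For a map given by left recursion, [f (val w * x) + val w * f x] is the datum [actM w x], so the
    degree is tested on the data alone. *)
Lemma lowers_degree_rec (f : Omega -> Omega) :
  (forall x y, f (x + y) = f x + f y) -> (forall a, f (iota a) = 0) ->
  (forall n (w : Omega1) x, x \in deg n -> f (val w * x) + val w * f x \in deg n) ->
  lowers_degree f.
Proof.
move=> fD fA fM; split=> [x /degree0P[a ->] //|n x hx].
(* There is no degree -1; in degree 0, lowering the degree means vanishing. *)
pose Q m x := if m is m'.+1 then f x \in deg m' else f x = 0.
suff : Q n.+1 x by [].
apply: (degree_ind (P := Q)) hx => {n x} //= [[|n]|[|n]|n w x hx] /=.
- exact: additive_zero.
- by rewrite additive_zero // rpred0.
- by move=> x y fx fy; rewrite fD fx fy addr0.
- by move=> x y fx fy; rewrite fD rpredD.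
- move=> Qx; rewrite -(addrK (val w * f x) (f _)) rpredB ?fM //.
  by case: n hx Qx => [|n] hx /= Qx; [rewrite Qx mulr0 rpred0|apply: formM_deg].
Qed.

Lemma antiderivation_rec (f : Omega -> Omega) :
  (forall x y, f (x + y) = f x + f y) -> f 1 = 0 ->
  (forall a x, f (iota a * x) = iota a * f x) ->
  (forall (w : Omega1) x, f (val w * x) = f (val w) * x - val w * f x) ->
  antiderivation f.
Proof.
move=> fD f1 fA fM n x y hx; elim/degree_ind: hx => {n x} [a|n|n u v hu hv|n w x hx IHx].
- have fa : f (iota a) = 0 by rewrite -[iota a]mulr1 fA f1 mulr0.
  by rewrite fA fa mul0r add0r mul1r.
- by rewrite !mul0r additive_zero // mul0r mulr0 addr0.
- rewrite mulrDl !fD hu hv mulrDl mulrDl mulrDr; ncring.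
- rewrite -mulrA !fM IHx exprS -signr_odd.
  by case: (odd n); rewrite ?expr0 ?expr1; ncring.
Qed.

(** * Interior derivations *)

Section Extension.
Variables (v : Omega1 -> A) (f : Omega -> Omega).
Hypothesis fP : extends_form_map v f.

Let f_lin : linear f. Proof. by case: fP. Qed.

Lemma ext_iota a : f (iota a) = 0.
Proof. by case: fP => _ [h _] _ _; apply/h/iota_deg. Qed.

Lemma ext_one : f 1 = 0.
Proof. by rewrite -iota1 ext_iota. Qed.

Lemma ext_scale a x : f (iota a * x) = iota a * f x.
Proof.
case: fP => _ _ h _.
by rewrite (h _ _ x (iota_deg a)) ext_iota mul0r add0r expr0 mul1r.
Qed.

Lemma ext_formM (w : Omega1) x : f (val w * x) = iota (v w) * x - val w * f x.
Proof. by case: fP => _ _ h hv; rewrite (h _ _ x (valP w)) hv expr1 mulN1r. Qed.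

End Extension.

(** Left recursion with [actA] zero and [actM w x = iota (v w) * x]. The antisymmetry hypothesis
    holds because the coefficients [v w] are central, so its four terms cancel in pairs. *)
Lemma extension_exists (v : Omega1 -> A) :
  linear (v : Omega1 -> A^o) -> exists f, extends_form_map v f.
Proof.
move=> v_lin.
have vD w u : v (w + u) = v w + v u := linear_add v_lin w u.
have vZ a w : v (a *: w) = a * v w := linear_scale v_lin a w.
have [||||||||f [fD f1 fA fM]] := @left_recursion (fun _ _ => 0) (fun w x => iota (v w) * x).
- by move=> *; rewrite addr0.
- by move=> *; rewrite addr0.
- by move=> w u x; rewrite vD iotaD mulrDl.
- by move=> *; rewrite mulrDr.
- by move=> *; rewrite mulr0 addr0.
- by move=> a w x; rewrite vZ iotaM mulrA addr0.
- by move=> w a x; rewrite mulr0 subr0 addr0 iotaCA.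
- by move=> w u x; rewrite !iotaCA; ncring.
have {}fA a x : f (iota a * x) = iota a * f x by rewrite fA addr0.
have fw w : f (val w) = iota (v w) by rewrite -[val w]mulr1 fM f1 mulr0 subr0 mulr1.
have fa a : f (iota a) = 0 by rewrite -[iota a]mulr1 fA f1 mulr0.
exists f; split=> //.
- exact: module_map_linear.
- apply: lowers_degree_rec => // n w x hx.
  by rewrite fM subrK iotaM_deg.
- by apply: antiderivation_rec => // w x; rewrite fM fw.
Qed.

Lemma extends_unique (v : Omega1 -> A) (f h : Omega -> Omega) :
  extends_form_map v f -> extends_form_map v h -> f = h.
Proof.
move=> fP hP; have [[f_lin _ _ _] [h_lin _ _ _]] := (fP, hP).
apply/funext; elim/generated_form1_ind.
- by rewrite (ext_one fP) (ext_one hP).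
- by move=> x y ex ey; rewrite (linear_add f_lin) (linear_add h_lin) ex ey.
- by move=> a x ex; rewrite (ext_scale fP) (ext_scale hP) ex.
- by move=> w x ex; rewrite (ext_formM fP) (ext_formM hP) ex.
Qed.

Lemma extensionP (v : Omega1 -> A) :
  linear (v : Omega1 -> A^o) -> extends_form_map v (extension v).
Proof.
move=> /extension_exists[f fP].
exact: (xgetPex _ (P := [set h | extends_form_map v h]%classic)) (ex_intro _ f fP).
Qed.

Lemma extension_eq (v : Omega1 -> A) f : extends_form_map v f -> extension v = f.
Proof.
move=> fP; apply: (extends_unique _ fP).
exact: (xgetPex _ (P := [set h | extends_form_map v h]%classic)) (ex_intro _ f fP).
Qed.

(** The anticommutator kills 1 and commutes with left multiplication by [iota a] and [val w], the
    terms with coefficients [u w] and [v w] cancelling. *)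
Lemma ext_anti (u v : Omega1 -> A) (f h : Omega -> Omega) :
  extends_form_map u f -> extends_form_map v h -> forall x, f (h x) + h (f x) = 0.
Proof.
move=> fP hP x; have [[f_lin _ _ _] [h_lin _ _ _]] := (fP, hP).
elim/generated_form1_ind: x => [|x y hx hy|b x hx|w x hx].
- by rewrite (ext_one fP) (ext_one hP) (linear_zero f_lin) (linear_zero h_lin) addr0.
- rewrite (linear_add f_lin x) (linear_add h_lin x) (linear_add f_lin) (linear_add h_lin).
  by rewrite addrACA hx hy addr0.
- rewrite (ext_scale fP) (ext_scale hP) (ext_scale fP) (ext_scale hP).
  by rewrite -mulrDr hx mulr0.
- rewrite (ext_formM fP) (ext_formM hP) (linear_sub f_lin) (linear_sub h_lin).
  rewrite (ext_formM fP) (ext_formM hP) (ext_scale fP) (ext_scale hP).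
  by transitivity (val w * (f (h x) + h (f x))); [ncring|rewrite hx mulr0].
Qed.

(** * Products of 1-forms and derivations *)

Lemma prod_skip0 n (F : 'I_n.+1 -> Omega) :
  \prod_(l < n.+1 | l != ord0) F l = \prod_(l < n) F (lift ord0 l).
Proof. by rewrite big_mkcond big_ord_recl /= mul1r. Qed.

Lemma prod_skipS n (j : 'I_n) (F : 'I_n.+1 -> Omega) :
  \prod_(l < n.+1 | l != lift ord0 j) F l =
  F ord0 * \prod_(l < n | l != j) F (lift ord0 l).
Proof.
rewrite big_mkcond big_ord_recl /=; congr (_ * _); rewrite [RHS]big_mkcond.
by apply: eq_bigr => l _; rewrite (inj_eq lift_inj).
Qed.

(** Sums of the forms on which [is_perp] prescribes values outright; that they exhaust [Omega] gives
    uniqueness of the contraction. *)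
Inductive product_span : Omega -> Prop :=
| span_alg a : product_span (iota a)
| span_prod m (w : 'I_m -> Omega1) : product_span (\prod_(i < m) val (w i))
| span_add x y : product_span x -> product_span y -> product_span (x + y).

Lemma product_spanT x : product_span x.
Proof.
have cons m (u : Omega1) (w : 'I_m -> Omega1) :
    product_span (val u * \prod_(i < m) val (w i)).
  have := span_prod (fun i : 'I_m.+1 => if unlift ord0 i is Some j then w j else u).
  by rewrite big_ord_recl unlift_none; under eq_bigr do rewrite liftK.
elim/generated_form1_ind: x => [|x y hx hy|a x|w x].
- by rewrite -iota1; apply: span_alg.
- exact: span_add.
(* The coefficient is absorbed into the first factor; the empty product leaves an element of [A]. *)
- elim=> {x} [b|[|m] w|x y _ hx _ hy].
  + by rewrite -iotaM; apply: span_alg.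
  + by rewrite big_ord0 mulr1; apply: span_alg.
  + by rewrite big_ord_recl mulrA -form1_valZ; apply: cons.
  + by rewrite mulrDr; apply: span_add.
- elim=> {x} [b|m v|x y _ hx _ hy].
  + have := cons 0%N (b *: w) (fun _ => 0).
    by rewrite big_ord0 mulr1 form1_valZ iotaC.
  + exact: cons.
  + by rewrite mulrDr; apply: span_add.
Qed.

Lemma derivation_rec (f : Omega -> Omega) :
  (forall x y, f (x + y) = f x + f y) ->
  (forall a x, f (iota a * x) = f (iota a) * x + iota a * f x) ->
  (forall (w : Omega1) x, f (val w * x) = f (val w) * x + val w * f x) ->
  forall x y, f (x * y) = f x * y + x * f y.
Proof.
move=> fD fA fM x y; elim/generated_form1_ind: x => [|x z hx hz|a x hx|w x hx].
- have f1 : f 1 = 0.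
    by have := fA 1 1; rewrite iota1 !mul1r mulr1 -{1}[f 1]addr0 => /addrI.
  by rewrite !mul1r f1 mul0r add0r.
- rewrite mulrDl !fD hx hz; ncring.
- by rewrite -mulrA fA hx (fA a x); ncring.
- by rewrite -mulrA fM hx (fM w x); ncring.
Qed.

(** * Contraction with a pairing *)

Section Pairing.
Variable g : form_pairing Omega.
Hypothesis g_bil : bilinear_pairing g.
Local Notation ip w := (extension (g w)).

Lemma pairing_addr w u v : g w (u + v) = g w u + g w v.
Proof. by case: g_bil => /(_ w) h _; apply: (linear_add h). Qed.

Lemma pairing_addl w u v : g (u + v) w = g u w + g v w.
Proof. by case: g_bil => _ /(_ w) h; apply: (linear_add h). Qed.

Lemma pairing_scaler w a v : g w (a *: v) = a * g w v.
Proof. by case: g_bil => /(_ w) h _; apply: (linear_scale h). Qed.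

Lemma pairing_scalel w a v : g (a *: v) w = a * g v w.
Proof. by case: g_bil => _ /(_ w) h; apply: (linear_scale h). Qed.

Lemma pairing_zeror w : g w 0 = 0.
Proof. by case: g_bil => /(_ w) h _; apply: (linear_zero h). Qed.

Lemma pairing_zerol w : g 0 w = 0.
Proof. by case: g_bil => _ /(_ w) h; apply: (linear_zero h). Qed.

Lemma pairing_suml w I (s : seq I) F :
  g (\sum_(i <- s) F i) w = \sum_(i <- s) g (F i) w.
Proof. by case: g_bil => _ /(_ w) h; apply: (linear_bigsum h). Qed.

Lemma ipP w : extends_form_map (g w) (ip w).
Proof. by apply: extensionP; case: g_bil. Qed.

Lemma ip_lin w : linear (ip w).
Proof. by case: (ipP w). Qed.

Lemma ip_add w x y : ip w (x + y) = ip w x + ip w y.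
Proof. exact: (linear_add (ip_lin w)). Qed.

Lemma ip_sub w x y : ip w (x - y) = ip w x - ip w y.
Proof. exact: (linear_sub (ip_lin w)). Qed.

Lemma ip_zero w : ip w 0 = 0.
Proof. exact: (linear_zero (ip_lin w)). Qed.

Lemma ip_iota w a : ip w (iota a) = 0.
Proof. exact: (ext_iota (ipP w)). Qed.

Lemma ip_one w : ip w 1 = 0.
Proof. exact: (ext_one (ipP w)). Qed.

Lemma ip_scale w a x : ip w (iota a * x) = iota a * ip w x.
Proof. exact: (ext_scale (ipP w)). Qed.

Lemma ip_form w v : ip w (val v) = iota (g w v).
Proof. by case: (ipP w). Qed.

Lemma ip_formM w v x : ip w (val v * x) = iota (g w v) * x - val v * ip w x.
Proof. exact: (ext_formM (ipP w)). Qed.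

Lemma ip_deg w n x : x \in deg n.+1 -> ip w x \in deg n.
Proof. by case: (ipP w) => _ [_ h] _ _; apply: h. Qed.

Lemma ip_deg0 w x : x \in deg 0 -> ip w x = 0.
Proof. by case: (ipP w) => _ [h _] _ _; apply: h. Qed.

Lemma ip_mul w n x y : x \in deg n ->
  ip w (x * y) = ip w x * y + (-1) ^+ n * (x * ip w y).
Proof. by case: (ipP w) => _ _ h _; apply: h. Qed.

Lemma ip_addl w v x : ip (w + v) x = ip w x + ip v x.
Proof.
elim/generated_form1_ind: x => [|x y hx hy|a x hx|u x hx].
- by rewrite !ip_one addr0.
- by rewrite !ip_add hx hy addrACA.
- by rewrite !ip_scale hx mulrDr.
- by rewrite !ip_formM hx pairing_addl iotaD; ncring.
Qed.

Lemma ip_scalel a w x : ip (a *: w) x = iota a * ip w x.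
Proof.
elim/generated_form1_ind: x => [|x y hx hy|b x hx|u x hx].
- by rewrite !ip_one mulr0.
- by rewrite !ip_add hx hy mulrDr.
- by rewrite !ip_scale hx iotaCA.
- by rewrite !ip_formM hx pairing_scalel iotaM -mulrA (iotaCA a (val u)) mulrBr.
Qed.

Lemma ip_zerol x : ip 0 x = 0.
Proof. by rewrite -(scale0r (0 : Omega1)) ip_scalel iota0 mul0r. Qed.

Lemma ip_anti w v x : ip w (ip v x) + ip v (ip w x) = 0.
Proof. exact: ext_anti (ipP w) (ipP v) x. Qed.

Lemma ip_prod w n (v : 'I_n -> Omega1) :
  ip w (\prod_(j < n) val (v j)) =
  \sum_(j < n) (-1) ^+ j * (iota (g w (v j)) * \prod_(l < n | l != j) val (v l)).
Proof.
elim: n v => [|n IHn] v; first by rewrite !big_ord0 ip_one.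
rewrite !big_ord_recl ip_formM IHn prod_skip0 expr0 mul1r; congr (_ + _).
rewrite mulr_sumr -sumrN; apply: eq_bigr => j _.
by rewrite prod_skipS signCA iotaCA lift0 exprS mulN1r mulNr.
Qed.

(** Expansion along the first factor of the left argument, which turns the double sum for the
    contraction into a left recursion in [x] with [y] fixed. *)
Definition perp_recursion (P : Omega -> Omega -> Omega) : Prop :=
  [/\ forall y, P 1 y = 0, forall a x y, P (iota a * x) y = iota a * P x y
    & forall w x y, P (val w * x) y = x * ip w y - val w * P x y].

Lemma perp_exists : exists P, is_perp g P /\ perp_recursion P.
Proof.
have /choice [Q HQ] (y : Omega) : exists f : Omega -> Omega,
    [/\ forall x z, f (x + z) = f x + f z, f 1 = 0,
        forall a x, f (iota a * x) = iota a * f x + 0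
      & forall w x, f (val w * x) = x * ip w y - val w * f x].
  have [||||||||f fP] := @left_recursion (fun _ _ => 0) (fun w x => x * ip w y);
    last by exists f.
  - by move=> *; rewrite addr0.
  - by move=> *; rewrite addr0.
  - by move=> w v x; rewrite ip_addl mulrDr.
  - by move=> *; rewrite mulrDl.
  - by move=> *; rewrite mulr0 addr0.
  - by move=> a w x; rewrite ip_scalel iotaCA addr0.
  - by move=> w a x; rewrite mulr0 subr0 addr0 mulrA.
  - by move=> w v x; ncring.
pose P x y := Q y x.
have PD x z y : P (x + z) y = P x y + P z y by rewrite /P; case: (HQ y).
have P1 y : P 1 y = 0 by rewrite /P; case: (HQ y).
have PZ a x y : P (iota a * x) y = iota a * P x y.
  by rewrite /P; case: (HQ y) => _ _ -> _; rewrite addr0.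
have PM w x y : P (val w * x) y = x * ip w y - val w * P x y.
  by rewrite /P; case: (HQ y) => _ _ _ ->.
exists P; split; last by split.
split.
- move=> x c y z; elim/generated_form1_ind: x => [|x x' hx hx'|a x hx|w x hx].
  + by rewrite !P1 scaler0 addr0.
  + by rewrite !PD hx hx' scalerDr addrACA.
  + by rewrite !PZ hx mulrDr scalerAr.
  + by rewrite !PM hx ip_lin !mulrDr -!scalerAr scalerBr opprD addrACA.
- by move=> y; apply: module_map_linear.
- move=> x y [/degree0P[a ->]|hy]; first by rewrite -[iota a]mulr1 PZ P1 mulr0.
  elim/generated_form1_ind: x => [|x x' hx hx'|a x hx|w x hx].
  + exact: P1.
  + by rewrite PD hx hx' addr0.
  + by rewrite PZ hx mulr0.
  + by rewrite PM hx (ip_deg0 _ hy) !mulr0 subr0.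
(* The terms with [i = 0] form [x * ip w y] by [ip_prod]. The others are the recursive term, its
   minus sign coming from the index shift. *)
- move=> m n w v; elim: m w => [|m IHm] w; first by rewrite !big_ord0 P1.
  rewrite !big_ord_recl PM IHm; congr (_ + _).
    rewrite ip_prod mulr_sumr; apply: eq_bigr => j _.
    by rewrite prod_skip0 add0n signCA iotaCA mulrA.
  rewrite mulr_sumr -sumrN; apply: eq_bigr => i _.
  rewrite mulr_sumr -sumrN; apply: eq_bigr => j _.
  by rewrite prod_skipS lift0 addSn exprS mulN1r mulNr signCA -!mulrA iotaCA.
Qed.

Lemma is_perp_unique P Q : is_perp g P -> is_perp g Q -> P = Q.
Proof.
move=> [P_linr P_linl P0 PE] [Q_linr Q_linl Q0 QE].
apply/funext => x; apply/funext => y.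
elim: (product_spanT x) => {x} [a|m w|x x' _ hx _ hx'].
- by rewrite P0 ?Q0 //; left; apply: iota_deg.
- elim: (product_spanT y) => {y} [a|n v|y y' _ hy _ hy'].
  + by rewrite P0 ?Q0 //; right; apply: iota_deg.
  + by rewrite PE QE.
  + by rewrite (linear_add (P_linr _)) (linear_add (Q_linr _)) hy hy'.
- by rewrite (linear_add (P_linl y)) (linear_add (Q_linl y)) hx hx'.
Qed.

Lemma perpP : is_perp g (perp g) /\ perp_recursion (perp g).
Proof.
have [P [HP RP]] := perp_exists.
suff -> : perp g = P by [].
apply: (is_perp_unique _ HP).
exact: (xgetPex _ (P := [set h | is_perp g h]%classic)) (ex_intro _ P HP).
Qed.

Lemma perp_linr x : linear (perp g x).
Proof. by have [[h _ _ _] _] := perpP; apply: h. Qed.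

Lemma perp_addr x y z : perp g x (y + z) = perp g x y + perp g x z.
Proof. exact: (linear_add (perp_linr x)). Qed.

Lemma perp_addl x y z : perp g (x + y) z = perp g x z + perp g y z.
Proof. by have [[_ h _ _] _] := perpP; apply: (linear_add (h z)). Qed.

Lemma perp_zerol z : perp g 0 z = 0.
Proof. by have [[_ h _ _] _] := perpP; apply: (linear_zero (h z)). Qed.

Lemma perp_scalel a x y : perp g (iota a * x) y = iota a * perp g x y.
Proof. by have [_ []] := perpP. Qed.

Lemma perp_iota x a : perp g x (iota a) = 0.
Proof. by have [[_ _ h _] _] := perpP; apply: h; right; apply: iota_deg. Qed.

(** In [nabla] the left argument is [d (val w)], of degree 2, so the facts needed there follow from
    this formula by [degree2_ind]. *)
Lemma perp_form2 (w v : Omega1) x :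
  perp g (val w * val v) x = val v * ip w x - val w * ip v x.
Proof.
have [_ [P1 _ PM]] := perpP.
by rewrite PM -[in perp g (val v) x](mulr1 (val v)) PM P1 mulr0 subr0 mul1r.
Qed.

Lemma perp_deg q n x : q \in deg 2 -> x \in deg n -> perp g q x \in deg n.
Proof.
move=> hq hx; elim/degree2_ind: hq => [|p r hp hr|w v].
- by rewrite perp_zerol rpred0.
- by rewrite perp_addl rpredD.
- rewrite perp_form2; case: n hx => [|n] hx.
    by rewrite !(ip_deg0 _ hx) !mulr0 subr0 rpred0.
  by rewrite rpredB // formM_deg // ip_deg.
Qed.

Lemma perp_scaler q a x : q \in deg 2 -> perp g q (iota a * x) = iota a * perp g q x.
Proof.
move=> hq; elim/degree2_ind: hq => [|p r hp hr|w v].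
- by rewrite !perp_zerol mulr0.
- by rewrite !perp_addl hp hr mulrDr.
- by rewrite !perp_form2 !ip_scale !iotaCA mulrBr.
Qed.

Lemma perp_formr q (v : Omega1) : q \in deg 2 -> symmetric_pairing g ->
  perp g q (val v) = ip v q.
Proof.
move=> hq g_sym; elim/degree2_ind: hq => [|p r hp hr|w u].
- by rewrite perp_zerol ip_zero.
- by rewrite perp_addl ip_add hp hr.
- by rewrite perp_form2 ip_formM !ip_form !iotaC (g_sym v w) (g_sym v u).
Qed.

(** An interior derivation followed by left multiplication by a 1-form is an even derivation, since
    the two signs cancel. *)
Lemma perp_formM q (v : Omega1) x : q \in deg 2 ->
  perp g q (val v * x) = perp g q (val v) * x + val v * perp g q x.
Proof.
move=> hq; elim/degree2_ind: hq => [|p r hp hr|w u].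
- by rewrite !perp_zerol mul0r mulr0 addr0.
- by rewrite !perp_addl hp hr mulrDl mulrDr addrACA.
- rewrite !perp_form2 !ip_formM !ip_form !mulrBr (formCA u v) (formCA w v); ncring.
Qed.

End Pairing.

(** * Codifferentials of classical type *)

Lemma interior_product_addl (delta : Omega -> Omega) i w v x :
  interior_product delta i -> i (w + v) x = i w x + i v x.
Proof. by case=> _ [h _] _ _ _; have := h 1 w v x; rewrite scale1r iota1 mul1r. Qed.

Lemma interior_product0 (delta : Omega -> Omega) (i : Omega1 -> Omega -> Omega) x :
  interior_product delta i -> i 0 x = 0.
Proof.
move=> ip; have := interior_product_addl 0 0 x ip.
by rewrite addr0 -[LHS]addr0 => /addrI.
Qed.

Lemma interior_product_scalel (delta : Omega -> Omega) i a (w : Omega1) x :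
  interior_product delta i -> i (a *: w) x = iota a * i w x.
Proof.
move=> ip; case: (ip) => _ [h _] _ _ _.
by rewrite -[a *: w]addr0 h (interior_product0 x ip) addr0.
Qed.

Lemma interior_product_unique (delta : Omega -> Omega) i j :
  interior_product delta i -> interior_product delta j -> i = j.
Proof.
move=> iP jP; apply/funext => w; apply/funext => x.
elim/exact_ind: w => [|w v hw hv|a w hw|a].
- by rewrite (interior_product0 x iP) (interior_product0 x jP).
- by rewrite (interior_product_addl _ _ _ iP) (interior_product_addl _ _ _ jP) hw hv.
- by rewrite (interior_product_scalel _ _ _ iP) (interior_product_scalel _ _ _ jP) hw.
- have [[_ _ hi _ _] [_ _ hj _ _]] := (iP, jP).
  by apply: (addrI (iota a * delta x)); rewrite -hi -hj.
Qed.

Lemma interior_eq (delta : Omega -> Omega) i : interior_product delta i -> interior delta = i.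
Proof.
move=> iP; apply: (interior_product_unique _ iP).
exact: (xgetPex _ (P := [set j | interior_product delta j]%classic)) (ex_intro _ i iP).
Qed.

(** Expanding [delta (delta (iota a * x))] leaves the anticommutator of [delta] with [i_da] as the
    only obstruction to [A]-linearity of the square. Serves both for translates and for the
    codifferential rebuilt from a connection. *)
Lemma classical_codifferential_of (g : form_pairing Omega) (delta : Omega -> Omega) :
  bilinear_pairing g -> symmetric_pairing g -> linear delta -> lowers_degree delta ->
  (forall a x, delta (iota a * x) = iota a * delta x + extension (g (d1 Omega a)) x) ->
  (forall a x, delta (extension (g (d1 Omega a)) x)
               + extension (g (d1 Omega a)) (delta x) = 0) ->
  [/\ classical_codifferential delta, metric delta = g
    & interior delta = fun w => extension (g w)].
Proof.
move=> g_bil g_sym d_lin d_low dA d_anti.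
have iP : interior_product delta (fun w => extension (g w)).
  split=> //.
  - by move=> w; case: (ipP g_bil w).
  - split=> [a w v x|a w x]; last exact: ip_scale.
    by rewrite ip_addl // ip_scalel.
  - by move=> a; case: (ipP g_bil (d1 Omega a)).
  - by move=> a b; rewrite !ip_form // g_sym.
have iE := interior_eq iP; split=> //.
- split=> //; last by exists (fun w => extension (g w)).
  move=> a x; rewrite dA (linear_add d_lin) dA -addrA.
  by rewrite [_ + delta _]addrC d_anti addr0.
- apply/funext => w; apply/funext => v.
  by rewrite /metric iE ip_form // to_algK.
Qed.

(** * A fixed codifferential and its translates *)

Section Codifferential.
Variable delta : Omega -> Omega.
Hypothesis deltaP : classical_codifferential delta.
Local Notation g := (metric delta).

Lemma delta_lin : linear delta. Proof. by case: deltaP. Qed.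

Lemma delta_low : lowers_degree delta. Proof. by case: deltaP. Qed.

Lemma interiorP : interior_product delta (interior delta).
Proof. by have [_ _ _ [i iP]] := deltaP; rewrite (interior_eq iP). Qed.

Lemma metricE w v : iota (g w v) = interior delta w (val v).
Proof.
apply: iota_to_alg; have [h _ _ _ _] := interiorP.
by have [_ [_ h1]] := h w; apply/h1/valP.
Qed.

(** The derivation rule is assumed for exact forms only; it passes to all [w] by linearity in
    [w]. *)
Lemma interior_extends w : extends_form_map (g w) (interior delta w).
Proof.
have iP := interiorP; have [h _ _ hd _] := iP; split; last by move=> v; rewrite metricE.
- by case: (h w).
- by case: (h w).
- elim/exact_ind: w => [|w v hw hv|a w hw|a] n x y hx //.
  + by rewrite !(interior_product0 _ iP) mul0r !mulr0 addr0.
  + by rewrite !(interior_product_addl _ _ _ iP) (hw _ _ _ hx) (hv _ _ _ hx); ncring.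
  + rewrite !(interior_product_scalel _ _ _ iP) (hw _ _ _ hx) mulrDr signCA.
    by rewrite (iotaCA a x) mulrA.
  + exact: hd.
Qed.

Lemma interiorE w : interior delta w = extension (g w).
Proof. by rewrite (extension_eq (interior_extends w)). Qed.

Lemma metric_bilinear : bilinear_pairing g.
Proof.
have iP := interiorP; have [h [h1 h2] _ _ _] := iP.
split=> [w|v] a u z; apply: (@of_alg_inj _ _ Omega); rewrite iotaD iotaM metricE.
- by case: (h w) => hl _; rewrite form1_valD form1_valZ (linear_add hl) h2 -!metricE.
- by rewrite h1 -!metricE.
Qed.

Lemma metric_symmetric : symmetric_pairing g.
Proof.
have [_ _ _ _ hs] := interiorP; have gb := metric_bilinear.
move=> w v; elim/exact_ind: w => [|w u hw hu|a w hw|a].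
- by rewrite (pairing_zerol gb) (pairing_zeror gb).
- by rewrite (pairing_addl gb) (pairing_addr gb) hw hu.
- by rewrite (pairing_scalel gb) (pairing_scaler gb) hw.
elim/exact_ind: v => [|w u hw hu|b w hw|b].
- by rewrite (pairing_zerol gb) (pairing_zeror gb).
- by rewrite (pairing_addl gb) (pairing_addr gb) hw hu.
- by rewrite (pairing_scalel gb) (pairing_scaler gb) hw.
- by apply: (@of_alg_inj _ _ Omega); rewrite !metricE hs.
Qed.

Lemma deltaA a x : delta (iota a * x) = iota a * delta x + extension (g (d1 Omega a)) x.
Proof. by have [_ _ h _ _] := interiorP; rewrite h interiorE. Qed.

Lemma delta_iota a : delta (iota a) = 0.
Proof. by have [h _] := delta_low; apply/h/iota_deg. Qed.

Lemma delta_ip a x :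
  delta (extension (g (d1 Omega a)) x) + extension (g (d1 Omega a)) (delta x) = 0.
Proof.
have [_ _ h _] := deltaP; have := h a x.
rewrite deltaA (linear_add delta_lin) deltaA -addrA -[RHS]addr0 => /addrI.
by rewrite addrC.
Qed.

Section Translate.
Variable f : Omega -> Omega.
Hypothesis fI : interior_coderivation f.

(** An interior coderivation is [A]-linear and anticommutes with every [i_da] by [ext_anti], so
    adding it preserves both hypotheses of [classical_codifferential_of]. *)
Lemma translateP : [/\ classical_codifferential (delta \+ f),
  metric (delta \+ f) = g & interior (delta \+ f) = interior delta].
Proof.
have [v [_ fP]] := fI; have [f_lin f_low _ _] := fP.
have gb := metric_bilinear.
have [|||||| H1 H2 H3] := @classical_codifferential_of g (delta \+ f).
- exact: metric_bilinear.
- exact: metric_symmetric.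
- move=> c x y /=; rewrite delta_lin f_lin scalerDr addrACA //.
- have [d0 d1] := delta_low; have [f0 f1] := f_low.
  split=> [x hx|n x hx] /=; first by rewrite d0 // f0 // addr0.
  by rewrite rpredD ?d1 ?f1.
- by move=> a x /=; rewrite deltaA (ext_scale fP) mulrDr addrAC.
- move=> a x /=; rewrite (ip_add gb) addrACA delta_ip add0r.
  exact: (ext_anti fP (ipP gb _)).
- by split=> //; rewrite H3; apply/funext => w; rewrite interiorE.
Qed.

(** [L] is additive in its codifferential and vanishes on antiderivations; the metric and interior
    product do not change. *)
Lemma Theta_translate : Theta (delta \+ f) = Theta delta.
Proof.
have [_ mE iE] := translateP; rewrite /Theta mE; congr pair.
apply/funext => w; apply/funext => x; rewrite /nabla mE iE; congr (_ *: (_ + _ + _)).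
have [v [_ fP]] := fI; rewrite /L /= (ext_formM fP) expr1.
by have [_ _ _ ->] := fP; ncring.
Qed.

End Translate.
End Codifferential.

Lemma interior_coderivation0 : interior_coderivation (fun _ : Omega => 0).
Proof.
exists (fun _ => 0); split; first by move=> a x y; rewrite scaler0 addr0.
split=> //; last by move=> w; rewrite iota0.
- by move=> c x y; rewrite scaler0 addr0.
- by split=> // n x _; apply: rpred0.
- by move=> n x y _; rewrite mul0r !mulr0 addr0.
Qed.

Lemma interior_coderivation_lincomb (c : k) (f h : Omega -> Omega) :
  interior_coderivation f -> interior_coderivation h ->
  interior_coderivation (fun x => c *: f x + h x).
Proof.
move=> [u [u_lin [f_lin [f0 f1] fM fu]]] [v [v_lin [h_lin [h0 h1] hM hv]]].
exists (fun w => c%:A * u w + v w); split.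
  have uE a x y : u (a *: x + y) = a * u x + u y := u_lin a x y.
  have vE a x y : v (a *: x + y) = a * v x + v y := v_lin a x y.
  move=> a x y; rewrite uE vE.
  transitivity (a * (c%:A * u x + v x) + (c%:A * u y + v y)) => //.
  by rewrite !mulrDr (algCA a); ncring.
split.
- move=> b x y; rewrite f_lin h_lin !scalerDr !scalerA mulrC.
  by rewrite -!addrA; congr (_ + _); rewrite addrCA.
- split=> [x hx|n x hx]; first by rewrite f0 // h0 // scaler0 addr0.
  by rewrite rpredD ?h1 // rpredZ ?f1.
- move=> n x y hx; rewrite (fM _ _ _ hx) (hM _ _ _ hx) !iota_scale.
  by rewrite (mulrDr x) (iotaCA _ x) (mulrDr ((-1) ^+ n)) (iotaCA _ ((-1) ^+ n)); ncring.
- by move=> w; rewrite fu hv iotaD iotaM iota_scale.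
Qed.

Lemma Theta_inj_mod_coderivations (delta delta' : Omega -> Omega) :
  classical_codifferential delta -> classical_codifferential delta' ->
  Theta delta = Theta delta' ->
  exists2 f, interior_coderivation f & delta = delta' \+ f.
Proof.
move=> dP dP' [mE nE].
have iE : interior delta = interior delta'.
  by apply/funext => w; rewrite !interiorE // mE.
(* The Lie and contraction terms depend only on the metric, so they cancel and leave [L]. *)
have LE (w : Omega1) x : L delta 1 (val w) x = L delta' 1 (val w) x.
  have := congr1 (fun D : connection Omega => D w x) nE; rewrite /nabla mE iE.
  by move/(scalerI (invr_neq0 two_neq0))/addIr/addIr.
clear nE; have [d_lin d_lin'] := (delta_lin dP, delta_lin dP').
pose f x := delta x - delta' x.
have f_low : lowers_degree f.
  have [[h0 h1] [h0' h1']] := (delta_low dP, delta_low dP').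
  split=> [x hx|n x hx]; first by rewrite /f h0 ?h0' ?subr0.
  by rewrite rpredB ?h1 ?h1'.
have f_lin : linear f.
  by move=> c x y; rewrite /f d_lin d_lin' scalerBr opprD addrACA.
have fA a x : f (iota a * x) = iota a * f x.
  by rewrite /f !deltaA // mE; ncring.
have fM (w : Omega1) x : f (val w * x) = f (val w) * x - val w * f x.
  have := LE w x; rewrite /L expr1 /f => e.
  have -> : delta (val w * x) = (delta' (val w * x) - delta' (val w) * x
    - -1 * (val w * delta' x)) + delta (val w) * x + -1 * (val w * delta x).
    by rewrite -e; ncring.
  ncring.
have fE (w : Omega1) : f (val w) = iota (to_alg (f (val w))).
  by rewrite iota_to_alg //; have [_ h] := f_low; apply/h/valP.
exists f; last by apply/funext => x; rewrite /f /= addrC subrK.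
exists (fun w => to_alg (f (val w))); split.
  move=> a w v; apply: (@of_alg_inj _ _ Omega); rewrite iotaD iotaM -fE.
  by rewrite form1_valD form1_valZ (linear_add f_lin) fA {1}(fE w) {1}(fE v).
split=> //; apply: antiderivation_rec => //; first exact: (linear_add f_lin).
by have [h _] := f_low; rewrite -iota1; apply/h/iota_deg.
Qed.

(** * The differential on generators *)

Lemma diffD x y : d (x + y) = d x + d y.
Proof. exact: raddfD. Qed.

Lemma diffB x y : d (x - y) = d x - d y.
Proof. exact: raddfB. Qed.

Lemma diff0 : d 0 = 0.
Proof. exact: raddf0. Qed.

Lemma diff_iotaM a x : d (iota a * x) = val (d1 Omega a) * x + iota a * d x.
Proof. by rewrite (diffM _ (iota_deg a)) expr0 mul1r. Qed.

Lemma diff_formM (w : Omega1) x : d (val w * x) = d (val w) * x - val w * d x.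
Proof. by rewrite (diffM _ (valP w)) expr1 mulN1r. Qed.

Lemma diff_form_deg (w : Omega1) : d (val w) \in deg 2.
Proof. exact: diff_degree (valP w). Qed.

Lemma diff_exact a : d (val (d1 Omega a)) = 0.
Proof. exact: diff_diff. Qed.

Lemma diff_one : d 1 = 0.
Proof.
have := diff_iotaM 1 1; rewrite iota1 !mul1r mulr1 -[LHS]add0r => /addIr.
by rewrite [X in 0 = X -> _]/= iota1.
Qed.

Lemma d1D a b : d1 Omega (a + b) = d1 Omega a + d1 Omega b.
Proof. by apply: val_inj; rewrite /= !raddfD. Qed.

Lemma d1M a b : d1 Omega (a * b) = a *: d1 Omega b + b *: d1 Omega a.
Proof. by apply: val_inj; rewrite /= iotaM diff_iotaM iotaC addrC. Qed.

Lemma d1_scalar (c : k) : d1 Omega c%:A = 0.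
Proof. by apply: val_inj; rewrite /= !linearZ rmorph1 /= diff_one scaler0. Qed.

Lemma d1_zero : d1 Omega 0 = 0.
Proof. by rewrite -(scale0r (1 : A)) d1_scalar. Qed.

(** * Lie derivative and nondegeneracy *)

Section LieDerivative.
Variable g : form_pairing Omega.
Hypothesis g_bil : bilinear_pairing g.
Local Notation ip w := (extension (g w)).
Local Notation Lie := (Lie (fun w => extension (g w))).

Lemma Lie_add w x y : Lie w (x + y) = Lie w x + Lie w y.
Proof. by rewrite /Defs.Lie !(ip_add g_bil, diffD); ncring. Qed.

Lemma Lie_addl w v x : Lie (w + v) x = Lie w x + Lie v x.
Proof. by rewrite /Defs.Lie !(ip_addl g_bil, diffD); ncring. Qed.

Lemma Lie_one w : Lie w 1 = 0.
Proof. by rewrite /Defs.Lie (ip_one g_bil) diff_one diff0 (ip_zero g_bil) addr0. Qed.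

Lemma Lie_form w (u : Omega1) :
  Lie w (val u) = val (d1 Omega (g w u)) + ip w (d (val u)).
Proof. by rewrite /Defs.Lie (ip_form g_bil). Qed.

Lemma Lie_scale w a x : Lie w (iota a * x) = iota a * Lie w x + iota (g w (d1 Omega a)) * x.
Proof.
rewrite /Defs.Lie diff_iotaM (ip_scale g_bil) diff_iotaM (ip_add g_bil).
by rewrite (ip_formM g_bil) (ip_scale g_bil); ncring.
Qed.

Lemma Lie_scalel a w x : Lie (a *: w) x = iota a * Lie w x + val (d1 Omega a) * ip w x.
Proof. by rewrite /Defs.Lie !(ip_scalel g_bil) diff_iotaM; ncring. Qed.

Lemma Lie_formM w (u : Omega1) x : Lie w (val u * x) = Lie w (val u) * x + val u * Lie w x.
Proof.
rewrite Lie_form /Defs.Lie (ip_formM g_bil) diffB diff_iotaM diff_formM diff_formM.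
rewrite (ip_sub g_bil) (ip_mul g_bil _ _ (diff_form_deg u)) (ip_formM g_bil).
by rewrite sqrrN expr1n mul1r; ncring.
Qed.

Lemma Lie_deg w n x : x \in deg n -> Lie w x \in deg n.
Proof.
move=> hx; rewrite rpredD //; last by apply: (ip_deg g_bil); apply: diff_degree.
case: n hx => [|n] hx; first by rewrite (ip_deg0 g_bil _ hx) diff0 rpred0.
by apply/diff_degree/(ip_deg g_bil).
Qed.

End LieDerivative.

Section Nondegeneracy.
Variable g : form_pairing Omega.
Hypothesis g_bil : bilinear_pairing g.
Local Notation ip w := (extension (g w)).

(* The algebra endomorphism induced by [w |-> w - \sum_p g(p.2, w) p.1] on 1-forms. *)
Fixpoint deflate (s : seq (Omega1 * Omega1)) (x : Omega) : Omega :=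
  if s is p :: s' then deflate s' x - val p.1 * deflate s' (ip p.2 x) else x.

Lemma deflate_cons p s x :
  deflate (p :: s) x = deflate s x - val p.1 * deflate s (ip p.2 x).
Proof. by []. Qed.

Lemma deflate_add s x y : deflate s (x + y) = deflate s x + deflate s y.
Proof. by elim: s x y => //= p s IHs x y; rewrite (ip_add g_bil) !IHs; ncring. Qed.

Lemma deflate_zero s : deflate s 0 = 0.
Proof. by elim: s => //= p s IHs; rewrite (ip_zero g_bil) IHs mulr0 subr0. Qed.

Lemma deflate_sub s x y : deflate s (x - y) = deflate s x - deflate s y.
Proof. by apply: (addIr (deflate s y)); rewrite -deflate_add !subrK. Qed.

Lemma deflate_scale s a x : deflate s (iota a * x) = iota a * deflate s x.
Proof.
elim: s x => //= p s IHs x.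
by rewrite (ip_scale g_bil) !IHs iotaCA mulrBr.
Qed.

Lemma deflate_iota s a : deflate s (iota a) = iota a.
Proof. by elim: s => //= p s IHs; rewrite (ip_iota g_bil) IHs deflate_zero mulr0 subr0. Qed.

Lemma deflate_form s (w : Omega1) :
  deflate s (val w) = val (w - \sum_(p <- s) g p.2 w *: p.1).
Proof.
elim: s => [|p s IHs] /=; first by rewrite big_nil subr0.
by rewrite IHs (ip_form g_bil) deflate_iota big_cons /= iotaC; ncring.
Qed.

(** For a single pair [p], the two sides differ by a term containing [val p.1] twice, which
    vanishes; the list is treated by induction. *)
Lemma deflate_formM s (w : Omega1) x :
  deflate s (val w * x) = deflate s (val w) * deflate s x.
Proof.
elim: s w x => [//|p s IHs] w x.
rewrite !deflate_cons (ip_formM g_bil) (ip_form g_bil) deflate_iota deflate_sub deflate_scale !IHs.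
rewrite deflate_form; move: (w - _) (deflate s (ip _ _)) (deflate s x) => W Y X.
have eW : val W * (val p.1 * Y) = - (val p.1 * (val W * Y)) by rewrite formCA.
have eg : val p.1 * iota (g p.2 w) * (val p.1 * Y) = 0.
  by rewrite iotaC -mulrA (mulrA (val p.1)) form_sq mul0r mulr0.
by rewrite mulrBl !mulrBr eW eg; ncring.
Qed.

Lemma nondegenerate n x : invertible_pairing g -> x \in deg n.+1 ->
  (forall w, ip w x = 0) -> x = 0.
Proof.
move=> [s hs] hx x0.
have <- : deflate s x = x.
  by elim: s {hs} => //= p s ->; rewrite x0 deflate_zero mulr0 subr0.
elim/degreeS_ind: hx {x0} => [|y z hy hz|w y _].
- exact: deflate_zero.
- by rewrite deflate_add hy hz addr0.
(* By invertibility [deflate s] kills 1-forms, hence, being multiplicative, everything of positive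
   degree; yet it fixes [x]. *)
rewrite deflate_formM deflate_form.
suff -> : \sum_(p <- s) g p.2 w *: p.1 = w by rewrite subrr mul0r.
apply: val_inj; rewrite form1_val_sum -[RHS](hs w).2.
by apply: eq_bigr => p _; rewrite form1_valZ iotaC.
Qed.

Lemma nondegenerate_exact n x : invertible_pairing g -> x \in deg n.+1 ->
  (forall a, ip (d1 Omega a) x = 0) -> x = 0.
Proof.
move=> gi hx x0; apply: (nondegenerate gi hx) => w.
elim/exact_ind: w => [|w v hw hv|a w hw|a] //.
- exact: ip_zerol.
- by rewrite (ip_addl g_bil) hw hv addr0.
- by rewrite (ip_scalel g_bil) hw mulr0.
Qed.

End Nondegeneracy.

(** * From codifferentials to connections *)

Section Connection.
Variables (g : form_pairing Omega) (D : connection Omega).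
Hypotheses (g_bil : bilinear_pairing g) (g_sym : symmetric_pairing g)
  (D_cov : covariant_derivative g D).
Local Notation ip w := (extension (g w)).

Lemma ip_to_form1 w x : x \in deg 1 -> iota (g w (to_form1 x)) = ip w x.
Proof. by move=> hx; rewrite -(ip_form g_bil) to_form1K. Qed.

Lemma conn_deg1 w (u : Omega1) : D w (val u) \in deg 1.
Proof. by case: D_cov => _ h _ _; apply/h/valP. Qed.

Lemma conn_add w x y : D w (x + y) = D w x + D w y.
Proof. by case: D_cov => h _ _ _; apply: (linear_add (h w)). Qed.

Lemma conn_zero w : D w 0 = 0.
Proof. by case: D_cov => h _ _ _; apply: (linear_zero (h w)). Qed.

Lemma conn_addl w v x : D (w + v) x = D w x + D v x.
Proof. by case: D_cov => _ _ h _; have := h 1 w v x; rewrite scale1r iota1 mul1r. Qed.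

Lemma conn_zerol x : D 0 x = 0.
Proof. by have := conn_addl 0 0 x; rewrite addr0 -[LHS]addr0 => /addrI. Qed.

Lemma conn_scalel a w x : D (a *: w) x = iota a * D w x.
Proof. by case: D_cov => _ _ h _; rewrite -[a *: w]addr0 h conn_zerol addr0. Qed.

Lemma conn_scale w a x : D w (iota a * x) = iota a * D w x + iota (g w (d1 Omega a)) * x.
Proof. by case: D_cov. Qed.

Lemma metric_compatibleP : metric_compatible g D <->
  forall w v u : Omega1, iota (g w (d1 Omega (g v u))) =
    ip u (D w (val v)) + ip v (D w (val u)).
Proof.
split=> h w v u.
  by rewrite h iotaD -!ip_to_form1 ?conn_deg1 // (g_sym u).
apply: (@of_alg_inj _ _ Omega).
by rewrite h iotaD (g_sym (to_form1 _)) -!ip_to_form1 ?conn_deg1.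
Qed.

Lemma torsion_freeP : torsion_free g D <->
  forall w v u : Omega1,
    ip w (D v (val u)) - ip v (D w (val u)) = ip w (ip v (d (val u))).
Proof.
by split=> h w v u; rewrite -h iotaB -!ip_to_form1 ?conn_deg1.
Qed.

Lemma metric_compatible_exact :
  (forall w a b, iota (g w (d1 Omega (g (d1 Omega a) (d1 Omega b)))) =
     ip (d1 Omega b) (D w (val (d1 Omega a))) + ip (d1 Omega a) (D w (val (d1 Omega b)))) ->
  metric_compatible g D.
Proof.
move=> h; apply/metric_compatibleP.
(* Both sides have the same Leibniz rule under scaling of [u]. Symmetry of [g] lets the same step
   handle [v] afterwards. *)
have step w v : (forall b, iota (g w (d1 Omega (g v (d1 Omega b)))) =
     ip (d1 Omega b) (D w (val v)) + ip v (D w (val (d1 Omega b)))) ->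
   forall u, iota (g w (d1 Omega (g v u))) = ip u (D w (val v)) + ip v (D w (val u)).
  move=> hv; elim/exact_ind => [|u u' hu hu'|a u hu|a] //.
  - rewrite (pairing_zeror g_bil) d1_zero (pairing_zeror g_bil) iota0.
    by rewrite (ip_zerol g_bil) conn_zero (ip_zero g_bil) addr0.
  - rewrite (pairing_addr g_bil) d1D (pairing_addr g_bil) iotaD hu hu'.
    by rewrite (ip_addl g_bil) form1_valD conn_add (ip_add g_bil); ncring.
  - rewrite (pairing_scaler g_bil) d1M (pairing_addr g_bil) !(pairing_scaler g_bil).
    rewrite iotaD !iotaM hu (ip_scalel g_bil) form1_valZ conn_scale (ip_add g_bil).
    by rewrite !(ip_scale g_bil) (ip_form g_bil) (iotaC (g v u)); ncring.
move=> w v u; apply: (step w v) => b; rewrite addrC (g_sym v).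
exact: (step w (d1 Omega b)).
Qed.

(** The torsion condition is tensorial in all three arguments, and for exact [u] its right side
    vanishes because [d] squares to zero. *)
Lemma torsion_free_exact :
  (forall a b c, ip (d1 Omega a) (D (d1 Omega b) (val (d1 Omega c))) =
     ip (d1 Omega b) (D (d1 Omega a) (val (d1 Omega c)))) ->
  torsion_free g D.
Proof.
move=> h; apply/torsion_freeP => w v u.
elim/exact_ind: w => [|w w' hw hw'|a w hw|a].
- by rewrite !(ip_zerol g_bil) conn_zerol (ip_zero g_bil) subr0.
- by rewrite !(ip_addl g_bil) conn_addl (ip_add g_bil) -hw -hw'; ncring.
- by rewrite !(ip_scalel g_bil) conn_scalel (ip_scale g_bil) -hw mulrBr.
elim/exact_ind: v => [|v v' hv hv'|b v hv|b].
- by rewrite !(ip_zerol g_bil) conn_zerol !(ip_zero g_bil) subr0.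
- by rewrite !(ip_addl g_bil) conn_addl !(ip_add g_bil) -hv -hv'; ncring.
- by rewrite !(ip_scalel g_bil) conn_scalel !(ip_scale g_bil) -hv mulrBr.
elim/exact_ind: u => [|u u' hu hu'|c u hu|c].
- by rewrite form1_val0 diff0 !conn_zero !(ip_zero g_bil) subr0.
- by rewrite form1_valD diffD !conn_add !(ip_add g_bil) -hu -hu'; ncring.
- rewrite form1_valZ diff_iotaM !conn_scale !(ip_add g_bil) !(ip_scale g_bil).
  rewrite (ip_formM g_bil) (ip_sub g_bil) !(ip_scale g_bil) -hu !(ip_form g_bil).
  rewrite (iotaC _ (val (d1 Omega c))) (ip_scale g_bil) (ip_form g_bil).
  by rewrite (iotaC (g (d1 Omega a) (d1 Omega c))); ncring.
- by rewrite diff_exact !(ip_zero g_bil) h subrr.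
Qed.

End Connection.

(** * The operator [L] and the connection of a codifferential *)

Section ToConnection.
Variable delta : Omega -> Omega.
Hypothesis deltaP : classical_codifferential delta.
Local Notation g := (metric delta).
Local Notation ip w := (extension (g w)).
Local Notation Lie := (Lie (fun w => extension (g w))).
Local Notation L w := (L delta 1 (val (w : Omega1))).

Let g_bil : bilinear_pairing g. Proof. exact: metric_bilinear. Qed.

Let g_sym : symmetric_pairing g. Proof. exact: metric_symmetric. Qed.

Lemma L_formE w x : L w x = delta (val w * x) - delta (val w) * x + val w * delta x.
Proof. by rewrite /Defs.L expr1; ncring. Qed.

Lemma L_add w x y : L w (x + y) = L w x + L w y.
Proof. by rewrite !L_formE !mulrDr !(linear_add (delta_lin deltaP)); ncring. Qed.

Lemma L_addl w v x : L (w + v) x = L w x + L v x.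
Proof.
by rewrite !L_formE form1_valD mulrDl !(linear_add (delta_lin deltaP)); ncring.
Qed.

Lemma L_scale w a x : L w (iota a * x) = iota a * L w x + iota (g (d1 Omega a) w) * x.
Proof.
rewrite !L_formE iotaCA !(deltaA deltaP) (ip_formM g_bil) iotaCA.
by rewrite mulrDr iotaCA; ncring.
Qed.

Lemma L_scalel a w x : L (a *: w) x = iota a * L w x - val w * ip (d1 Omega a) x.
Proof.
rewrite !L_formE form1_valZ -mulrA !(deltaA deltaP) (ip_formM g_bil) (ip_form g_bil).
ncring.
Qed.

Lemma L_one w : L w 1 = 0.
Proof.
have d1 : delta 1 = 0 by rewrite -iota1 delta_iota.
by rewrite L_formE !mulr1 d1 mulr0 subrr addr0.
Qed.

Lemma L_iota w a : L w (iota a) = iota (g (d1 Omega a) w).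
Proof. by rewrite -[iota a]mulr1 L_scale L_one mulr0 add0r mulr1. Qed.

Lemma L_deg w n x : x \in deg n -> L w x \in deg n.
Proof.
move=> hx; have [d0 dS] := delta_low deltaP; rewrite L_formE.
rewrite rpredD ?rpredB ?dS ?formM_deg //.
  by rewrite -(iota_to_alg (dS _ _ (valP w))) iotaM_deg.
case: n hx => [|n] hx; first by rewrite d0 // mulr0 rpred0.
by rewrite formM_deg ?dS.
Qed.

(* The form in which [A]-linearity of [delta \o delta] enters. *)
Lemma ip_L a w x : ip (d1 Omega a) (L w x) =
  L w (ip (d1 Omega a) x) - ip (d1 Omega (g (d1 Omega a) w)) x.
Proof.
have [_ dS] := delta_low deltaP.
have := delta_ip deltaP a (val w * x).
rewrite !L_formE (ip_formM g_bil) (linear_sub (delta_lin deltaP)) (deltaA deltaP).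
rewrite (ip_add g_bil) (ip_sub g_bil) (ip_formM g_bil).
rewrite -(iota_to_alg (dS _ _ (valP w))) (ip_scale g_bil).
have := delta_ip deltaP a x => /addr0_eq <-.
move=> /addr0_eq <-; ncring.
Qed.

Hypothesis g_inv : invertible_pairing g.

(** By [ip_L], contracting the defect with [i_da] gives a defect for [ip (d1 Omega a) y], of lower
    degree, plus terms that cancel. Induction on the degree of [y] and nondegeneracy conclude. *)
Lemma L_formM w (u : Omega1) x : L w (val u * x) = L w (val u) * x + val u * L w x.
Proof.
have hLu := L_deg w (valP u).
suff defect n : forall y, y \in deg n ->
    L w (val u * y) = L w (val u) * y + val u * L w y.
  have [n [c [hc ->]]] := degree_span x.
  rewrite mulr_sumr mulr_sumr.
  have LS : L w (\sum_(i < n) c i) = \sum_(i < n) L w (c i).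
    apply: (big_morph (L w) (L_add w)); exact: additive_zero (L_add w).
  rewrite LS mulr_sumr -big_split /=.
  rewrite (big_morph (L w) (L_add w) (additive_zero (L_add w))).
  by apply: eq_bigr => i _; apply: defect.
elim: n => [|n IHn] y hy.
  move/degree0P: hy => [b ->].
  by rewrite !iotaC L_scale L_iota iotaC.
apply/subr0_eq/(nondegenerate_exact (n := n.+1) g_bil g_inv).
  apply: rpredB; first by apply/L_deg/formM_deg.
  by apply: rpredD; [exact: (degreeM hLu hy)|apply/formM_deg/L_deg].
move=> a; rewrite (ip_sub g_bil _ (L w _)) (ip_add g_bil _ (L w _ * y)) ip_L !(ip_formM g_bil).
rewrite (ip_mul g_bil _ _ hLu) !ip_L (ip_form g_bil) L_iota (ip_form g_bil).
have -> : L w (iota (g (d1 Omega a) u) * y - val u * ip (d1 Omega a) y) =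
   L w (iota (g (d1 Omega a) u) * y) - L w (val u * ip (d1 Omega a) y).
  by apply: (addIr (L w (val u * ip (d1 Omega a) y))); rewrite -L_add !subrK.
rewrite L_scale (IHn _ (ip_deg g_bil _ hy)) expr1; ncring.
Qed.

Lemma nabla_double w x : nabla delta w x + nabla delta w x =
  L w x + Lie w x + perp g (d (val w)) x.
Proof.
have iE : interior delta = fun w => ip w by apply/funext => v; rewrite interiorE.
rewrite /nabla iE -mulr2n -scaler_nat scalerA mulfV ?scale1r //; exact: two_neq0.
Qed.

Lemma nabla_add w x y : nabla delta w (x + y) = nabla delta w x + nabla delta w y.
Proof.
apply: double_inj; rewrite [RHS]addrACA !nabla_double L_add (Lie_add g_bil).
by rewrite (perp_addr g_bil); ncring.
Qed.

Lemma nabla_addl w v x : nabla delta (w + v) x = nabla delta w x + nabla delta v x.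
Proof.
apply: double_inj; rewrite [RHS]addrACA !nabla_double L_addl (Lie_addl g_bil).
by rewrite form1_valD diffD (perp_addl g_bil); ncring.
Qed.

(** None of the three summands is [A]-linear in [w]; their errors [- w i_da x], [da i_w x] and
    [w i_da x - da i_w x] add up to zero. *)
Lemma nabla_scalel a w x : nabla delta (a *: w) x = iota a * nabla delta w x.
Proof.
apply: double_inj; rewrite -mulrDr !nabla_double L_scalel (Lie_scalel g_bil).
rewrite form1_valZ diff_iotaM (perp_addl g_bil) (perp_scalel g_bil) (perp_form2 g_bil).
ncring.
Qed.

(** [L] and [Lie] contribute one copy of [(w, da) x] each and the contraction none, so halving
    leaves exactly one. *)
Lemma nabla_scale w a x :
  nabla delta w (iota a * x) = iota a * nabla delta w x + iota (g w (d1 Omega a)) * x.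
Proof.
apply: double_inj; rewrite [RHS]addrACA -mulrDr !nabla_double L_scale (Lie_scale g_bil).
by rewrite (perp_scaler g_bil _ _ (diff_form_deg w)) (g_sym (d1 _ _)); ncring.
Qed.

Lemma nabla_covariant : covariant_derivative g (nabla delta).
Proof.
split.
- move=> w; apply: module_map_linear; first exact: nabla_add.
  by move=> c x; rewrite nabla_scale d1_scalar (pairing_zeror g_bil) iota0 mul0r addr0.
- move=> w n x hx; rewrite -[nabla delta w x]scale1r -(mulVf two_neq0) -scalerA rpredZ //.
  rewrite scaler_nat mulr2n nabla_double.
  apply: rpredD; last exact: (perp_deg g_bil (diff_form_deg w) hx).
  by apply: rpredD; [exact: L_deg|exact: (Lie_deg g_bil)].
- by move=> a w v x; rewrite nabla_addl nabla_scalel.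
- exact: nabla_scale.
Qed.

Lemma nabla_derivation : acts_by_derivations (nabla delta).
Proof.
move=> w; apply: derivation_rec; first exact: nabla_add.
- move=> a x; rewrite nabla_scale.
  have := nabla_scale w a 1; rewrite mulr1 => ->.
  have -> : nabla delta w 1 = 0.
    apply: double_eq0; rewrite nabla_double L_one (Lie_one g_bil).
    by rewrite -iota1 (perp_iota g_bil) !addr0.
  by rewrite mulr0 add0r mulr1 addrC.
- move=> u x; apply: double_inj; rewrite [RHS]addrACA -mulrDl -mulrDr !nabla_double.
  rewrite L_formM (Lie_formM g_bil) (perp_formM g_bil _ _ (diff_form_deg w)); ncring.
Qed.

(** A Koszul formula. Its last three terms are antisymmetric in [X] and [Y], which yields metric
    compatibility; for exact [w] it is symmetric in [w] and [Y], which yields torsion-freeness. *)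
Lemma ip_nabla_exact a b w :
  let X := d1 Omega a in let Y := d1 Omega b in
  ip Y (nabla delta w (val X)) + ip Y (nabla delta w (val X)) =
  iota (g w (d1 Omega (g X Y))) - iota (g X (d1 Omega (g w Y)))
  + iota (g Y (d1 Omega (g w X))) + ip Y (ip X (d (val w))).
Proof.
move=> X Y; rewrite -(ip_add g_bil) nabla_double (Lie_form g_bil) diff_exact.
rewrite (perp_formr g_bil _ (diff_form_deg w) g_sym) (ip_zero g_bil) addr0.
rewrite (ip_add g_bil _ (L w _ + _)) (ip_add g_bil _ (L w _)) ip_L !(ip_form g_bil) L_iota.
by rewrite (g_sym (d1 _ (g Y X))) (g_sym (d1 _ (g Y w))) (g_sym Y X) (g_sym Y w).
Qed.

Lemma nabla_metric_compatible : metric_compatible g (nabla delta).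
Proof.
apply: (metric_compatible_exact g_bil g_sym nabla_covariant) => w a b.
apply: double_inj; rewrite [RHS]addrACA !ip_nabla_exact (g_sym (d1 _ b) (d1 _ a)).
have := ip_anti g_bil (d1 Omega b) (d1 Omega a) (d (val w)) => /addr0_eq <-.
ncring.
Qed.

Lemma nabla_torsion_free : torsion_free g (nabla delta).
Proof.
apply: (torsion_free_exact g_bil nabla_covariant) => a b c.
apply: double_inj; rewrite !ip_nabla_exact !diff_exact !(ip_zero g_bil) !addr0.
rewrite (g_sym (d1 _ c) (d1 _ a)) (g_sym (d1 _ b) (d1 _ a)) (g_sym (d1 _ c) (d1 _ b)).
ncring.
Qed.

Lemma Theta_riemannian : riemannian_pair (Theta delta).
Proof.
split; split=> //=.
- exact: nabla_covariant.
- exact: nabla_metric_compatible.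
- exact: nabla_torsion_free.
- exact: nabla_derivation.
Qed.

End ToConnection.

(** * From connections to codifferentials *)

Section FromConnection.
Variables (g : form_pairing Omega) (D : connection Omega).
Hypotheses (g_bil : bilinear_pairing g) (g_sym : symmetric_pairing g)
  (D_cov : covariant_derivative g D) (D_met : metric_compatible g D)
  (D_tor : torsion_free g D) (D_der : acts_by_derivations D).
Local Notation ip w := (extension (g w)).
Local Notation Lie := (Lie (fun w => extension (g w))).

Let metE : forall w v u : Omega1, iota (g w (d1 Omega (g v u))) =
  ip u (D w (val v)) + ip v (D w (val u)).
Proof. exact/metric_compatibleP. Qed.

Let torE : forall w v u : Omega1,
  ip w (D v (val u)) - ip v (D w (val u)) = ip w (ip v (d (val u))).
Proof. exact/torsion_freeP. Qed.

Lemma conn_one w : D w 1 = 0.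
Proof.
have := D_der w 1 1; rewrite !mulr1 mul1r -{1}[D w 1]addr0 => /addrI <-.
by [].
Qed.

(* The value of [L_delta] forced by [Theta delta = (g, D)]. *)
Definition lder (w : Omega1) (x : Omega) : Omega :=
  D w x + D w x - Lie w x - perp g (d (val w)) x.

Lemma lder_add w x y : lder w (x + y) = lder w x + lder w y.
Proof.
by rewrite /lder !(conn_add D_cov) (Lie_add g_bil) (perp_addr g_bil); ncring.
Qed.

Lemma lder_addl w v x : lder (w + v) x = lder w x + lder v x.
Proof.
rewrite /lder !(conn_addl D_cov) (Lie_addl g_bil) form1_valD diffD.
by rewrite (perp_addl g_bil); ncring.
Qed.

Lemma lder_scale w a x : lder w (iota a * x) = iota a * lder w x + iota (g w (d1 Omega a)) * x.
Proof.
rewrite /lder !(conn_scale D_cov) (Lie_scale g_bil).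
by rewrite (perp_scaler g_bil _ _ (diff_form_deg w)); ncring.
Qed.

Lemma lder_scalel a w x : lder (a *: w) x = iota a * lder w x - val w * ip (d1 Omega a) x.
Proof.
rewrite /lder !(conn_scalel D_cov) (Lie_scalel g_bil) form1_valZ diff_iotaM.
by rewrite (perp_addl g_bil) (perp_scalel g_bil) (perp_form2 g_bil); ncring.
Qed.

Lemma lder_one w : lder w 1 = 0.
Proof.
by rewrite /lder conn_one (Lie_one g_bil) -iota1 (perp_iota g_bil) addr0 !subr0.
Qed.

Lemma lder_formM w (u : Omega1) x :
  lder w (val u * x) = lder w (val u) * x + val u * lder w x.
Proof.
rewrite /lder D_der (Lie_formM g_bil) (perp_formM g_bil _ _ (diff_form_deg w)).
ncring.
Qed.

Lemma lder_deg w n x : x \in deg n -> lder w x \in deg n.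
Proof.
have [_ D_deg _ _] := D_cov; move=> hx.
apply: rpredB; last exact: (perp_deg g_bil (diff_form_deg w) hx).
apply: rpredB; last exact: (Lie_deg g_bil).
by apply: rpredD; apply: D_deg.
Qed.

Hypothesis g_inv : invertible_pairing g.

(** By nondegeneracy it suffices to pair with an arbitrary [z]: metric compatibility expands the
    derivative of [(w, u)] along [z], and torsion-freeness exchanges [z] with [w] and with [u]. *)
Lemma conn_symmetrized (w u : Omega1) : D w (val u) + D u (val w) =
  val (d1 Omega (g w u)) + ip w (d (val u)) + ip u (d (val w)).
Proof.
apply/subr0_eq/(nondegenerate (n := 0%N) g_bil g_inv).
  apply: rpredB; first by apply: rpredD; apply: conn_deg1 D_cov _ _.
  apply: rpredD; last exact: (ip_deg g_bil _ (diff_form_deg w)).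
  by apply: rpredD; [exact: valP|exact: (ip_deg g_bil _ (diff_form_deg u))].
move=> z; rewrite (ip_sub g_bil) !(ip_add g_bil) (ip_form g_bil) metE.
have e1 : ip w (D z (val u)) = ip z (D w (val u)) + ip w (ip z (d (val u))).
  by rewrite -torE addrC subrK.
have e2 : ip u (D z (val w)) = ip z (D u (val w)) + ip u (ip z (d (val w))).
  by rewrite -torE addrC subrK.
rewrite e1 e2.
have /addr0_eq <- := ip_anti g_bil w z (d (val u)).
have /addr0_eq <- := ip_anti g_bil u z (d (val w)).
ncring.
Qed.

(** The symmetrized identity makes [lder] antisymmetric on 1-forms, as the antisymmetry hypothesis
    of [left_recursion] will require. *)
Lemma lder_form (w u : Omega1) : lder w (val u) = D w (val u) - D u (val w).
Proof.
rewrite /lder (Lie_form g_bil) (perp_formr g_bil _ (diff_form_deg w) g_sym).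
have -> : D u (val w) = val (d1 Omega (g w u)) + ip w (d (val u)) + ip u (d (val w))
    - D w (val u) by rewrite -conn_symmetrized; ncring.
ncring.
Qed.

Lemma ip_lder_form a (w u : Omega1) : ip (d1 Omega a) (lder w (val u)) =
  iota (g w (d1 Omega (g (d1 Omega a) u))) - iota (g (d1 Omega (g (d1 Omega a) w)) u).
Proof.
rewrite lder_form (ip_sub g_bil) (g_sym (d1 Omega (g _ w)) u) !metE.
have := torE w u (d1 Omega a); rewrite diff_exact !(ip_zero g_bil) => /subr0_eq ->.
ncring.
Qed.

(** The counterpart of [ip_L], now proved from the connection: [lder] is a derivation, so the case
    of 1-forms propagates. It will make the constructed codifferential anticommute with [i_da]. *)
Lemma ip_lder a w x : ip (d1 Omega a) (lder w x) =
  lder w (ip (d1 Omega a) x) - ip (d1 Omega (g (d1 Omega a) w)) x.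
Proof.
have lder0 : lder w 0 = 0 by apply: additive_zero; apply: lder_add.
have lderB y z : lder w (y - z) = lder w y - lder w z.
  by apply: (addIr (lder w z)); rewrite -lder_add !subrK.
elim/generated_form1_ind: x => [|x y hx hy|b x hx|u x hx].
- by rewrite lder_one (ip_one g_bil) lder0 !(ip_zero g_bil) (ip_one g_bil) subr0.
- by rewrite lder_add !(ip_add g_bil _ x) lder_add (ip_add g_bil _ (lder w x)) hx hy; ncring.
- rewrite lder_scale (ip_add g_bil _ (iota b * lder w x)) !(ip_scale g_bil).
  by rewrite lder_scale hx; ncring.
- have hu : lder w (val u) \in deg 1 by apply/lder_deg/valP.
  rewrite lder_formM (ip_add g_bil _ (lder w (val u) * x)) (ip_mul g_bil _ _ hu).
  rewrite !(ip_formM g_bil) ip_lder_form hx lderB lder_scale lder_formM expr1.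
  ncring.
Qed.

Lemma codifferential_exists : exists delta : Omega -> Omega,
  [/\ classical_codifferential delta, metric delta = g & nabla delta = D].
Proof.
have [s hs] := g_inv.
(* The divergence of [w], to be the value of [delta] on 1-forms. *)
pose div (w : Omega1) : A := \sum_(p <- s) g p.1 (to_form1 (D p.2 (val w))).
have divE w : iota (div w) = \sum_(p <- s) ip p.1 (D p.2 (val w)).
  rewrite (big_morph iota iotaD iota0); apply: eq_bigr => p _.
  exact: (ip_to_form1 g_bil _ (conn_deg1 D_cov _ _)).
have div_add w v : iota (div (w + v)) = iota (div w) + iota (div v).
  rewrite !divE -big_split; apply: eq_bigr => p _.
  by rewrite form1_valD (conn_add D_cov) (ip_add g_bil).
have div_scale a w : iota (div (a *: w)) = iota a * iota (div w) + iota (g (d1 Omega a) w).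
  (* Expanding [da] through the inverse metric matches it with the Leibniz terms of [D p.2]. *)
  have -> : d1 Omega a = \sum_(p <- s) g p.2 (d1 Omega a) *: p.1.
    apply: val_inj; rewrite form1_val_sum -[LHS](hs _).2.
    by apply: eq_bigr => p _; rewrite form1_valZ iotaC.
  rewrite !divE (pairing_suml g_bil) (big_morph iota iotaD iota0) mulr_sumr -big_split.
  apply: eq_bigr => p _; rewrite form1_valZ (conn_scale D_cov) (ip_add g_bil).
  by rewrite !(ip_scale g_bil) (ip_form g_bil) (pairing_scalel g_bil) iotaM.
(* This is the definition of [L] solved for [delta (val w * x)], with [div] as [delta (val w)] and
   [lder] as [L]. *)
have [||||||||delta [dD d_one dA dM]] := @left_recursion
  (fun a x => ip (d1 Omega a) x) (fun w x => iota (div w) * x + lder w x).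
- by move=> a b x; rewrite d1D (ip_addl g_bil).
- by move=> a x y; rewrite (ip_add g_bil).
- by move=> w v x; rewrite div_add lder_addl; ncring.
- by move=> w x y; rewrite lder_add; ncring.
- move=> a b x; rewrite d1M (ip_addl g_bil) !(ip_scalel g_bil) (ip_scale g_bil).
  by [].
- move=> a w x; rewrite div_scale lder_scalel (ip_formM g_bil); ncring.
- move=> w a x; rewrite lder_scale iotaCA (ip_formM g_bil) (g_sym w); ncring.
- move=> w v x; rewrite !lder_formM !mulrDr !iotaCA !lder_form; ncring.
have d_low : lowers_degree delta.
  apply: lowers_degree_rec => //.
    by move=> a; rewrite -[iota a]mulr1 dA d_one mulr0 (ip_one g_bil) addr0.
  move=> n w x hx; rewrite dM subrK; apply: rpredD; first exact: iotaM_deg.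
  exact: lder_deg.
have d_lin : linear delta.
  apply: module_map_linear => // c x.
  by rewrite dA d1_scalar (ip_zerol g_bil) addr0.
have d_form w : delta (val w) = iota (div w).
  by rewrite -[val w]mulr1 dM d_one mulr0 subr0 lder_one addr0 mulr1.
have d_anti a x : delta (ip (d1 Omega a) x) + ip (d1 Omega a) (delta x) = 0.
  elim/generated_form1_ind: x => [|x y hx hy|b x hx|w x hx].
  - by rewrite (ip_one g_bil) d_one (ip_zero g_bil) addr0 (linear_zero d_lin).
  - by rewrite dD !(ip_add g_bil) dD addrACA hx hy addr0.
  - rewrite dA (ip_add g_bil) !(ip_scale g_bil) dA.
    have /addr0_eq <- := ip_anti g_bil (d1 Omega a) (d1 Omega b) x.
    transitivity (iota b * (delta (ip (d1 Omega a) x) + ip (d1 Omega a) (delta x))).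
      ncring.
    by rewrite hx mulr0.
  - rewrite dM (ip_sub g_bil) (ip_add g_bil _ (iota (div w) * x)) !(ip_formM g_bil).
    rewrite (linear_sub d_lin) dA dM (ip_scale g_bil) ip_lder.
    transitivity (val w * (delta (ip (d1 Omega a) x) + ip (d1 Omega a) (delta x))).
      ncring.
    by rewrite hx mulr0.
have [dP mE iE] := classical_codifferential_of g_bil g_sym d_lin d_low dA d_anti.
exists delta; split=> //.
apply/funext => w; apply/funext => x; apply: double_inj.
rewrite (nabla_double dP) mE L_formE dM d_form /lder; ncring.
Qed.

End FromConnection.

End ClassicalType.

(** * Passage to the quotient *)

Theorem proposition2p10 (k : fieldType) (char_k : 2%N \notin [pchar k])
    (A : algType k) (Omega : dga A) (Omega_classical : classical_dga Omega) :
  let D := @classical_codifferential k A Omega in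
  let Dx := @invertible_codifferential k A Omega in
  let I := @interior_coderivation k A Omega in
  (* the data entering the definitions are well defined *)
  [/\ forall v : form1 Omega -> A, linear (v : form1 Omega -> A^o) ->
        exists! f, extends_form_map v f,
      forall delta, D delta -> exists! i, interior_product delta i
    & forall g : form_pairing Omega, bilinear_pairing g ->
        exists! P, is_perp g P] /\
  (* I is a vector space acting by addition *)
  [/\ I (fun _ => 0),
      forall (c : k) u v, I u -> I v -> I (fun x => c *: u x + v x),
      forall delta v, D delta -> I v -> D (delta \+ v)
    & forall delta v, Dx delta -> I v -> Dx (delta \+ v)] /\
  (* the induced map on the quotient *)
  exists Theta_bar : set (Omega -> Omega) ->
                     form_pairing Omega * connection Omega,
    [/\ forall delta, D delta -> Theta_bar (coset delta) = Theta delta,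
        set_inj (quotient D) Theta_bar
      & set_bij (quotient Dx) (@riemannian_pair k A Omega) Theta_bar].
Proof.
move=> D Dx I.
have I0 : I (fun _ => 0) := interior_coderivation0 Omega.
have IL : forall (c : k) u v, I u -> I v -> I (fun x => c *: u x + v x).
  exact: (interior_coderivation_lincomb Omega_classical).
have DI delta v : D delta -> I v -> D (delta \+ v).
  by move=> dP vI; have [] := translateP Omega_classical dP vI.
have DxI delta v : Dx delta -> I v -> Dx (delta \+ v).
  move=> [dP gi] vI; split; first exact: DI.
  by have [_ -> _] := translateP Omega_classical dP vI.
split; first split.
- move=> v /(extension_exists Omega_classical)[f fP].
  by exists f; split=> // h; apply: (extends_unique Omega_classical fP).
- move=> delta dP; exists (interior delta); split; first exact: (interiorP Omega_classical).
  by move=> i; apply: interior_product_unique (interiorP Omega_classical dP).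
- move=> g /(perp_exists Omega_classical)[P [HP _]].
  by exists P; split=> // Q; apply: (is_perp_unique Omega_classical HP).
split; first by split.
(* A choice of representative. Cosets are nonempty, as the zero coderivation shows, so the default
   value never occurs on them. *)
pose rep (S : set (Omega -> Omega)) := xget (fun _ => 0) S.
have repP delta : exists2 v, I v & rep (coset delta) = delta \+ v.
  have [v vI <-] : coset delta (rep (coset delta)); last by exists v.
  apply: (xgetPex _ (P := coset delta)); exists (delta \+ (fun _ => 0)).
  by exists (fun _ => 0).
have ThetaE delta : D delta -> Theta (rep (coset delta)) = Theta delta.
  move=> dP; have [v vI ->] := repP delta.
  exact: (Theta_translate Omega_classical dP vI).
have Theta_inj delta delta' : D delta -> D delta' ->
    Theta delta = Theta delta' -> coset delta = coset delta'.
  move=> dP dP' e.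
  have [f fI ef] := Theta_inj_mod_coderivations char_k Omega_classical dP dP' e.
  have addI u v : I u -> I v -> I (u \+ v).
    move=> uI vI; have := IL 1 _ _ uI vI.
    by congr (I _); apply/funext => x; rewrite scale1r.
  have oppI u : I u -> I (fun x => - u x).
    move=> uI; have := IL (-1) _ _ uI I0.
    by congr (I _); apply/funext => x; rewrite scaleN1r addr0.
  (* The representatives differ by [f] in [I], and [I] is closed under sums and negation. *)
  apply/seteqP; split=> _ [v vI <-].
  + exists (f \+ v); first exact: addI.
    by rewrite ef; apply/funext => x /=; rewrite addrA.
  + exists ((fun x => - f x) \+ v); first by apply: addI => //; apply: oppI.
    by rewrite ef; apply/funext => x /=; rewrite addrA addrK.
exists (fun S => Theta (rep S)); split=> //.
- move=> S S'; rewrite !inE => -[delta dP <-] [delta' dP' <-].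
  by rewrite !ThetaE //; apply: Theta_inj.
split.
- move=> _ [delta [dP gi] <-]; rewrite ThetaE //.
  exact: Theta_riemannian.
- move=> S S'; rewrite !inE => -[delta [dP _] <-] [delta' [dP' _] <-].
  by rewrite !ThetaE //; apply: Theta_inj.
- move=> [g nab] [[/= gb gs gi] [cov met tor der]].
  have [delta [dP mE nE]] := codifferential_exists char_k Omega_classical gb gs cov met tor der gi.
  exists (coset delta); first by exists delta => //; split=> //; rewrite mE.
  by rewrite ThetaE // /Theta mE nE.
Qed.
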